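(* Let $S_1,\dots,S_N$ be uniformly expanding compatible substitution rules on prototiles $t_1,\dots,t_M\subset\mathbb{R}^d$ with expansion constants $\bar\theta_1,\dots,\bar\theta_N>1$, and let $\mu$ be a minimal, $\sigma$-invariant ergodic probability measure on $\Sigma_N$. Then for $\mu$-almost every $x\in\Sigma_N$ there is a basis $\{b_1,\dots,b_d\}$ of $\mathbb{R}^d$ such that $$\Lambda_x\subset \mathbb{Z}[\bar\theta_1,\dots,\bar\theta_N]\,b_1+\cdots+\mathbb{Z}[\bar\theta_1,\dots,\bar\theta_N]\,b_d.$$
   Context: A substitution rule on compact prototiles $t_1,\dots,t_M\subset\mathbb{R}^d$ is a family of maps $f_{ijk}(y)=\theta y+\tau_{ijk}$ ($1\le k\le\kappa(i,j)$) with a single $\theta\in(0,1)$ (uniformly expanding, with expansion constant $\bar\theta=\theta^{-1}$) and $t_i=\bigcup_j\bigcup_kf_{ijk}(t_j)$, pieces meeting only on boundaries; substitution matrix $F_{ij}=\kappa(i,j)$. Let $\theta_\ell=\bar\theta_\ell^{-1}$ be the contraction of $S_\ell$, $\Sigma_N=\{1,\dots,N\}^{\mathbb{Z}\setminus\{0\}}$ with shift $\sigma$. For $x\in\Sigma_N$, a level-$k$ supertile of type $i$ is $(\theta_{x_1}\cdots\theta_{x_k})^{-1}t_i$ subdivided into translates of prototiles by successively applying $S_{x_k},\dots,S_{x_1}$; tilings are increasing unions of nested supertiles (via paths in the bi-infinite Bratteli diagram of $x$), and $\Omega_x$ is their tiling space (translation-orbit closure in the standard tiling metric). Compatible: supertiles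 are always tiled edge-to-edge with respect to fixed CW structures (finite local complexity). $\mu$ is minimal if for $\mu$-a.e. $x$ and every $m$ there is $n>m$ with $F_{x_n}\cdots F_{x_m}$ strictly positive (then $\Omega_x$ is well defined and its tilings are repetitive). $\Lambda_x$ is the set of return vectors: $\tau\in\mathbb{R}^d$ such that some tiling in $\Omega_x$ contains two tiles $t$ and $t+\tau$ that are translates of the same prototile. $\mathbb{Z}[\bar\theta_1,\dots,\bar\theta_N]$ is the subring of $\mathbb{R}$ generated by $\bar\theta_1,\dots,\bar\theta_N$. *)

(* Defs.v *)
From HB Require Import structures.
From mathcomp Require Import all_boot all_order all_algebra.
From mathcomp Require Import all_classical all_reals all_analysis.
From mathcomp Require Import zify.
Import numFieldNormedType.Exports.

Set Implicit Arguments.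
Unset Strict Implicit.
Unset Printing Implicit Defensive.

Import Order.TTheory GRing.Theory Num.Theory.
Local Open Scope classical_set_scope.
Local Open Scope ring_scope.

(* Symbols {1,...,N+1} of the shift space: 'I_N.+1 (so the number of        *)
(* substitution rules is N.+1 >= 1), made a pointedType.                     *)
Definition sym (n : nat) := 'I_n.+1.
HB.instance Definition _ n := Choice.on (sym n).
HB.instance Definition _ n := isPointed.Build (sym n) ord0.

(* Sigma_N = {1..N}^(Z \ {0}) is represented by int -> sym N, the entry at   *)
(* m >= 0 storing the coordinate x_(m+1) and the entry at m < 0 storing x_m. *)
Definition Sigma (N : nat) := (int -> sym N)%type.

(* The coordinate x_k, k in Z \ {0} (the value at k = 0 is meaningless). *)
Definition xc (N : nat) (x : Sigma N) (k : int) : sym N :=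
  if (0 < k)%R then x (k - 1)%R else x k.

(* The left shift: (sigma x)_k = x_(k+1) for k in Z\{0}, where the successor *)
(* of -1 in Z\{0} is 1.  In the representation above this is m |-> y (m+1). *)
Definition shift (N : nat) (x : Sigma N) : Sigma N := fun m => x (m + 1)%R.

Lemma shiftE (N : nat) (x : Sigma N) (k : int) : k != 0 ->
  xc (shift x) k = xc x (if k == -1 then 1 else k + 1).
Proof.
rewrite /xc /shift => k0.
have [->|km1] := eqVneq k (-1).
  by rewrite ltr01 /=; congr x; lia.
case: ifP => h1; case: ifP => h2; congr x; move: h1 h2 k0 km1; lia.
Qed.



Definition cylinders (N : nat) : set (set (Sigma N)) :=
  fun A => exists (m : int) (a : sym N), A = [set x | x m = a].

Definition SigmaM (N : nat) := g_sigma_algebraType (@cylinders N).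

Definition shift_invariant (R : realType) (N : nat)
  (mu : probability (SigmaM N) R) : Prop :=
  forall A : set (SigmaM N), measurable A -> mu (@shift N @^-1` A) = mu A.

Definition shift_ergodic (R : realType) (N : nat)
  (mu : probability (SigmaM N) R) : Prop :=
  forall A : set (SigmaM N), measurable A -> @shift N @^-1` A = A ->
    mu A = 0%E \/ mu A = 1%E.

Section Geometry.
Variables (R : realType) (d : nat).
Local Notation V := 'rV[R]_d.

Definition transl (A : set V) (v : V) : set V := [set a + v | a in A].
Definition scale (c : R) (A : set V) : set V := [set c *: a | a in A].
Definition sqn (v : V) : R := \sum_(i < d) (v ord0 i) ^+ 2.
End Geometry.

(* Substitution rules.  A family of N.+1 rules on prototiles t : 'I_M -> set V*)
(* is given by contractions theta l, multiplicities kappa l i j (= F_ij of   *)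
(* rule l) and translation vectors tau l i j k (only k < kappa l i j used).   *)
Section Substitutions.
Variables (R : realType) (d M N : nat).
Local Notation V := 'rV[R]_d.
Variables (t : 'I_M -> set V) (theta : sym N -> R)
  (kappa : sym N -> 'I_M -> 'I_M -> nat) (tau : sym N -> 'I_M -> 'I_M -> nat -> V).

Definition piece (l : sym N) (i j : 'I_M) (k : nat) : set V :=
  transl (scale (theta l) (t j)) (tau l i j k).

Definition substitution_rule (l : sym N) : Prop :=
  [/\ 0 < theta l < 1,
      (forall i, t i = [set p | exists j k, (k < kappa l i j)%N /\ piece l i j k p])
    & (forall i j k j' k', (k < kappa l i j)%N -> (k' < kappa l i j')%N ->
        (j, k) <> (j', k') ->
        @interior V (piece l i j k) `&` @interior V (piece l i j' k') = set0)].

Definition Fmx (l : sym N) : 'M[int]_M := \matrix_(i, j) (kappa l i j)%:Z.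

Fixpoint prodF (x : Sigma N) (m : nat) (k : nat) : 'M[int]_M :=
  match k with
  | 0 => Fmx (xc x m%:Z)
  | k'.+1 => Fmx (xc x (m + k)%N%:Z) *m prodF x m k'
  end.

Definition strictly_positive (A : 'M[int]_M) : Prop := forall i j, 0 < A i j.

Definition minimal (mu : probability (SigmaM N) R) : Prop :=
  {ae mu, forall x : SigmaM N, forall m : nat, (0 < m)%N ->
     exists n : nat, (m < n)%N /\ strictly_positive (prodF x m (n - m))}.

Definition tile := ('I_M * V)%type.
Definition tile_set (tl : tile) : set V := transl (t tl.1) tl.2.
Definition transl_patch (P : set tile) (v : V) : set tile :=
  fun tl => P (tl.1, tl.2 - v).

Definition cexp (x : Sigma N) (n : nat) : R :=
  \prod_(1 <= m < n.+1) (theta (xc x m%:Z))^-1.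

(* Level-k supertile of type i for x: (theta_(x_1)...theta_(x_k))^-1 t_i     *)
(* subdivided by S_(x_k), ..., S_(x_1), as a set of tiles.                   *)
Fixpoint supertile (x : Sigma N) (k : nat) (i : 'I_M) : set tile :=
  match k with
  | 0 => [set (i, 0)]
  | k'.+1 => fun tl => exists (j : 'I_M) (l : nat),
      (l < kappa (xc x k'.+1%:Z) i j)%N /\
      supertile x k' j (tl.1, tl.2 - cexp x k'.+1 *: tau (xc x k'.+1%:Z) i j l)
  end.

(* T is a tiling of R^d which is an increasing union of nested supertiles *)
(* (a path ii in the Bratteli diagram of x, with placements vv).            *)
Definition built_tiling (x : Sigma N) (T : set tile) : Prop :=
  exists (ii : nat -> 'I_M) (vv : nat -> V),
    [/\ (forall k, exists l, (l < kappa (xc x k.+1%:Z) (ii k.+1) (ii k))%N /\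
           vv k = vv k.+1 + cexp x k.+1 *: tau (xc x k.+1%:Z) (ii k.+1) (ii k) l),
        T = (fun tl => exists k, transl_patch (supertile x k (ii k)) (vv k) tl)
      & (forall p : V, exists tl, T tl /\ tile_set tl p)].

Definition agree_on (r : R) (T T' : set tile) : Prop :=
  forall tl, (exists p, tile_set tl p /\ sqn p < r ^+ 2) -> (T tl <-> T' tl).

(* Omega_x: closure, in the standard tiling metric, of the translation orbits *)
(* of the tilings built from x.                                              *)
Definition Omega (x : Sigma N) (T : set tile) : Prop :=
  forall eps : R, 0 < eps -> exists T0 (w u u' : V),
    [/\ built_tiling x T0, sqn u < eps ^+ 2, sqn u' < eps ^+ 2
      & agree_on eps^-1 (transl_patch T (- u))
                        (transl_patch (transl_patch T0 w) (- u'))].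

Definition Lambda (x : Sigma N) (v : V) : Prop :=
  exists T, Omega x T /\ exists (j : 'I_M) (p : V), T (j, p) /\ T (j, p + v).

(* Compatibility: the prototiles carry fixed finite cell structures (nonempty *)
(* compact cells) and any two distinct tiles of any supertile, for any x and  *)
(* any level, meet exactly in a union of cells common to both (edge-to-edge). *)
Definition compatible : Prop :=
  exists (ncell : 'I_M -> nat) (cell : 'I_M -> nat -> set V),
    (forall i c, (c < ncell i)%N ->
       [/\ cell i c !=set0, @compact V (cell i c) & cell i c `<=` t i]) /\
    (forall (x : Sigma N) k i (tl tl' : tile),
       supertile x k i tl -> supertile x k i tl' -> tl <> tl' ->
       tile_set tl `&` tile_set tl' =
       [set p | exists c c', [/\ (c < ncell tl.1)%N, (c' < ncell tl'.1)%N,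
            transl (cell tl.1 c) tl.2 = transl (cell tl'.1 c') tl'.2
          & transl (cell tl.1 c) tl.2 p]]).

Inductive Zthetabar : R -> Prop :=
  | Zt_gen l : Zthetabar (theta l)^-1
  | Zt_one : Zthetabar 1
  | Zt_add a b : Zthetabar a -> Zthetabar b -> Zthetabar (a + b)
  | Zt_opp a : Zthetabar a -> Zthetabar (- a)
  | Zt_mul a b : Zthetabar a -> Zthetabar b -> Zthetabar (a * b).

End Substitutions.

(* Main.v *)
(** Let O be the ring generated by the expansion constants.  Return vectors are
    integer combinations of the finitely many adjacency vectors, so they have
    coordinates phi in a free O-module of finite rank, with phi additive and
    O-linear.  The point (an idea of Kenyon) is that every real linear relation
    between return vectors also holds for their coordinates; Cramer's rule over
    O then produces the basis.

    To see this, extend a coordinate psi of phi to a function F on R^d through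
    the position of a tile containing the point.  F is Lipschitz at large scale.
    Two points at large distance D between which F grows at almost the extremal
    rate (for the Euclidean norm) force F to be almost linear on a ball around
    their midpoint whose radius is a fixed small multiple of D.  By primitivity
    this ball contains supertiles of all types at a comparable level n, and F
    varies in the same way, up to a constant, on all level-n supertiles of a
    given type; hence F is linear up to an error eps |v| + O(1) on all of R^d.
    By Poincare recurrence the finite word that produces a return vector v
    occurs again at arbitrarily large places n, so that c_n v is a return vector
    too, where c_n is the expansion of the first n substitutions.  Since
    psi (c_n v) = c_n psi v, dividing by c_n removes the O(1). *)

Require Import Defs.
From HB Require Import structures.
From mathcomp Require Import all_boot all_order all_algebra.
From mathcomp Require Import all_classical all_reals all_analysis.
From mathcomp Require Import zify ring lra.
Import Order.TTheory GRing.Theory Num.Theory.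
Import numFieldNormedType.Exports.
Local Open Scope classical_set_scope.
Local Open Scope ring_scope.

(** * Recurrence of finite words under the shift *)

Section Recurrence.
Variables (R : realType) (N : nat).

Lemma iter_shiftE n (x : Sigma N) (m : int) : iter n (@Defs.shift N) x m = x (m + n%:Z).
Proof.
elim: n m => [|n IH] m; first by rewrite addr0.
by rewrite [LHS]IH -addrA; congr (x (_ + _)); lia.
Qed.

Lemma measurable_shift_preimage (A : set (SigmaM N)) :
  measurable A -> measurable ((@Defs.shift N : SigmaM N -> SigmaM N) @^-1` A).
Proof.
move=> mA; rewrite -[X in measurable X]setTI.
have : measurable_fun setT (@Defs.shift N : SigmaM N -> SigmaM N); last exact.
apply: (measurability (@cylinders N : set (set (SigmaM N)))) => //.
move=> _ [_ [m [a ->]] <-]; rewrite setTI.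
by apply: sub_sigma_algebra; exists (m + 1), a.
Qed.

Lemma measurable_iter_shift (A : set (SigmaM N)) n :
  measurable A -> measurable ((iter n (@Defs.shift N) : SigmaM N -> SigmaM N) @^-1` A).
Proof.
move=> mA; elim: n => [//|n IH].
have -> : (iter n.+1 (@Defs.shift N) : SigmaM N -> SigmaM N) @^-1` A =
  (@Defs.shift N : SigmaM N -> SigmaM N) @^-1`
   ((iter n (@Defs.shift N) : SigmaM N -> SigmaM N) @^-1` A).
  by apply/seteqP; split => x; rewrite /preimage /= -iterSr.
exact: measurable_shift_preimage.
Qed.

Variable mu : probability (SigmaM N) R.
Hypothesis inv_mu : shift_invariant mu.

Lemma measure_iter_shift (A : set (SigmaM N)) n : measurable A ->
  mu ((iter n (@Defs.shift N) : SigmaM N -> SigmaM N) @^-1` A) = mu A.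
Proof.
move=> mA; elim: n => [//|n IH].
rewrite -[RHS]IH -[RHS]inv_mu; last exact: measurable_iter_shift.
congr (mu _).
by apply/seteqP; split => x; rewrite /preimage /= -iterSr.
Qed.

(** The points of [A] that never return form a set [B] whose preimages under the iterates are
    pairwise disjoint and of equal measure, so [B] is null. A point of [A] with finitely many visits
    is carried into [B] by its last visit. *)
Lemma poincare_recurrence (A : set (SigmaM N)) : measurable A ->
  {ae mu, forall x : SigmaM N, A x ->
     forall n0, exists n, (n0 <= n)%N /\ A (iter n (@Defs.shift N) x)}.
Proof.
move=> mA.
pose pr n (B : set (SigmaM N)) := (iter n (@Defs.shift N) : SigmaM N -> SigmaM N) @^-1` B.
pose B := A `\` \bigcup_n pr n.+1 A.
have mB : measurable B.
  apply: measurableD => //; apply: bigcupT_measurable => n.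
  exact: measurable_iter_shift.
have tB : trivIset setT (fun n => pr n B).
  apply: ltn_trivIset => m n mn; apply/seteqP; split => // x [] [Ax nx] [Ay ny].
  apply: nx; exists (m - n).-1 => //.
  rewrite /pr /preimage /mkset -iterD prednK ?subn_gt0 //.
  by rewrite subnK // ltnW.
have muB : mu B = 0%E.
  have h : (\sum_(0 <= i <oo) mu (pr i B) <= 1)%E.
    have mp i : measurable (pr i B) by exact: measurable_iter_shift.
    rewrite -(@measure_semi_bigcup _ _ _ mu) //; last exact: bigcupT_measurable.
    by apply: probability_le1; exact: bigcupT_measurable.
  have h2 : (\sum_(0 <= i <oo) mu (pr i B) = \sum_(0 <= i <oo) mu B)%E.
    by apply: eq_eseriesr => i _; rewrite /pr measure_iter_shift.
  apply/eqP; apply/negP => /negP n0.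
  have p0 : (0 < mu B)%E by rewrite lt0e n0 measure_ge0.
  have fB : mu B = (fine (mu B))%:E by rewrite fineK // fin_num_measure.
  rewrite fB lte_fin in p0.
  have := h; rewrite h2 => hle.
  (* More than [1 / mu B] disjoint copies of [B] would exceed the total mass 1. *)
  pose n := (Num.truncn (fine (mu B))^-1).+1.
  have := le_trans (@nneseries_lim_ge R (fun=> mu B) xpredT 0%N n
    (fun _ _ _ => measure_ge0 _ _)) hle.
  have -> : (\sum_(0 <= i < n) mu B = (n%:R * fine (mu B))%:E)%E.
    by rewrite fB sumEFin big_const_nat subn0 iter_addr_0 mulr_natl.
  rewrite lee_fin.
  rewrite leNgt => /negP; apply.
  rewrite -ltr_pdivrMr // mul1r /n.
  have /ltW/truncn_itv/andP[] // : 0 < (fine (mu B))^-1 by rewrite invr_gt0.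
suff : mu.-negligible (\bigcup_n pr n B).
  apply: negligibleS => x /= /not_implyP[Ax] /existsNP[n0 hn0].
  have hn n : (n0 <= n)%N -> ~ A (iter n (@Defs.shift N) x).
    by move=> h1 h2; apply: hn0; exists n.
  have P0 : exists n, `[< A (iter n (@Defs.shift N) x) >] by exists 0%N; apply/asboolP.
  have Pb n : `[< A (iter n (@Defs.shift N) x) >] -> (n <= n0)%N.
    by move=> /asboolP An; rewrite leqNgt; apply/negP => /ltnW /hn.
  case: (ex_maxnP P0 Pb) => n /asboolP An nmax.
  exists n => //; split => // -[j _] Aj.
  have /asboolP/nmax : A (iter (j.+1 + n) (@Defs.shift N) x) by rewrite iterD.
  by rewrite leqNgt addSn ltnS leq_addl.
apply: negligible_bigcup => n; apply/negligibleP; first exact: measurable_iter_shift.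
by rewrite -[RHS]muB; exact: measure_iter_shift.
Qed.

(** Finite words are countable, so the null sets excluded by Poincare recurrence for all cylinders
    can be discarded together; [pickle] enumerates the words. *)
Lemma recurrent_words :
  {ae mu, forall x : SigmaM N, forall k n0, exists n, (n0 <= n)%N /\
     forall j, (0 < j <= k)%N -> xc x (n + j)%N%:Z = xc x j%:Z}.
Proof.
pose A (w : seq 'I_N.+1) : set (SigmaM N) :=
  \bigcap_(j < size w) [set x | x j%:Z = nth ord0 w j].
have mA w : measurable (A w).
  apply: bigcap_measurableType.
  by move=> j _; apply: sub_sigma_algebra; exists j%:Z, (nth ord0 w j).
suff H : {ae mu, forall x : SigmaM N, forall m, forall w, unpickle m = Some w ->
   A w x -> forall n0, exists n, (n0 <= n)%N /\ A w (iter n (@Defs.shift N) x)}.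
  apply: filterS H => x H k n0.
  (* The coordinate x_(j+1) is stored at entry [j], so [w] is the word x_1 ... x_k. *)
  pose w := [seq x j%:Z | j <- iota 0 k].
  have Aw : A w x.
    by move=> j /=; rewrite size_map size_iota => jk; rewrite (nth_map 0%N) ?size_iota // nth_iota.
  have [n [n0n An]] := H _ w (pickleK w) Aw n0.
  exists n; split=> // j /andP[j0 jk].
  have jw : (j.-1 < size w)%N by rewrite size_map size_iota prednK.
  have := An j.-1 jw; rewrite /= iter_shiftE -(Aw j.-1 jw).
  rewrite /xc !ltz_nat addn_gt0 j0 orbT => e.
  have -> : (j%:Z - 1) = j.-1%:Z by lia.
  by rewrite -e; congr (x _); lia.
apply: ae_foralln => m; case: unpickle => [w|]; last by apply: aeW.
apply: filterS (poincare_recurrence _ (mA w)) => x H _ [<-].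
exact: H.
Qed.

End Recurrence.
Arguments recurrent_words {R N mu} _.

(** * Functions that are nearly linear on large balls *)

Section AsymptoticallyLinearBalls.
Variables (R : realType) (d : nat).
Local Notation V := 'rV[R]_d.

Definition dot (u v : V) : R := \sum_i u ord0 i * v ord0 i.

Lemma dotDl u u' v : dot (u + u') v = dot u v + dot u' v.
Proof. by rewrite -big_split; apply: eq_bigr => i _; rewrite mxE mulrDl. Qed.

Lemma dotC u v : dot u v = dot v u.
Proof. by apply: eq_bigr => i _; rewrite mulrC. Qed.

Lemma dotZl a u v : dot (a *: u) v = a * dot u v.
Proof. by rewrite mulr_sumr; apply: eq_bigr => i _; rewrite mxE mulrA. Qed.

Lemma dotNl u v : dot (- u) v = - dot u v.
Proof. by rewrite -scaleN1r dotZl mulN1r. Qed.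

Lemma sqn_ge0 (v : V) : 0 <= sqn v.
Proof. by apply: sumr_ge0 => i _; exact: sqr_ge0. Qed.

Lemma sqnD (u v : V) : sqn (u + v) = sqn u + 2 * dot u v + sqn v.
Proof.
rewrite /sqn /dot mulr_sumr -!big_split; apply: eq_bigr => i _ /=.
by rewrite mxE; ring.
Qed.

Lemma sqnZ a (v : V) : sqn (a *: v) = a ^+ 2 * sqn v.
Proof. by rewrite /sqn mulr_sumr; apply: eq_bigr => i _; rewrite mxE exprMn. Qed.

Lemma sqnN (v : V) : sqn (- v) = sqn v.
Proof. by rewrite -scaleN1r sqnZ sqrrN expr1n mul1r. Qed.

Lemma norm_rV_lt (v : V) (r : R) : 0 < r ->
  (forall i, `|v ord0 i| < r) -> `|v| < r.
Proof.
move=> r0 h; have [e|/mx_norm_neq0[[i j] e]] := eqVneq (mx_norm v) 0.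
  by have -> : `|v| = 0 := e.
by have -> : `|v| = `|v i j| := e; rewrite [i]ord1.
Qed.

Lemma norm_rV_ge (v : V) i : `|v ord0 i| <= `|v|.
Proof.
rewrite [X in _ <= X]mx_normrE.
exact: (@le_bigmax _ _ _ 0 (fun ij : 'I_1 * 'I_d => `|v ij.1 ij.2|) (ord0, i)).
Qed.

(** The norm of a row vector is the sup norm, while extremal slopes are taken in the Euclidean norm;
    this bound and [sqn_norm] convert between the two. *)
Lemma norm_sqn (v : V) : `|v| ^+ 2 <= sqn v.
Proof.
have [e|/mx_norm_neq0[[i j] e]] := eqVneq (mx_norm v) 0.
  by have -> : `|v| = 0 := e; rewrite expr0n sqn_ge0.
have -> : `|v| = `|v i j| := e; rewrite /= [i]ord1 real_normK ?num_real // /sqn (bigD1 j) //= lerDl.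
by apply: sumr_ge0 => k _; exact: sqr_ge0.
Qed.

Lemma sqn_norm (v : V) : sqn v <= d%:R * `|v| ^+ 2.
Proof.
have -> : d%:R * `|v| ^+ 2 = \sum_(i < d) `|v| ^+ 2.
  by rewrite sumr_const card_ord mulr_natl.
apply: ler_sum => i _; rewrite -[leLHS]real_normK ?num_real //.
by rewrite lerXn2r ?nnegrE // norm_rV_ge.
Qed.

Lemma telescope_ub (F : V -> R) (w : V) B :
  (forall a, F (a + w) - F a <= B) -> forall n a, F (a + n%:R *: w) - F a <= n%:R * B.
Proof.
move=> h; elim=> [|n IH] a; first by rewrite scale0r addr0 subrr mul0r.
have := h (a + n%:R *: w); have := IH a.
by rewrite -addrA -[X in _ + (_ + X)]scale1r -scalerDl natr1 -natr1 mulrDl; lra.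
Qed.

(* A pair at Euclidean distance at most D on which F increases by almost the
   extremal slope s pins F down near the midpoint of the pair. *)
Lemma extremal_slope_near_linear (F : V -> R) (s delta C D r : R) (a b z z' : V) :
  0 <= s -> 0 <= delta -> 0 < D -> 0 <= r ->
  (forall u v (e : R), 0 <= e -> sqn (v - u) <= e ^+ 2 ->
     F v - F u <= (s + delta) * e + C) ->
  sqn (b - a) <= D ^+ 2 -> s * D - 1 <= F b - F a ->
  sqn (z - 2^-1 *: (a + b)) <= r -> sqn (z' - 2^-1 *: (a + b)) <= r ->
  F z - F z' - dot (z - z') ((s / D) *: (b - a)) <=
    1 + 2 * C + 2 * delta * D + (2 * s + 4 * delta) * r / D.
Proof.
move=> s0 d0 D0 r0 hF hab hs.
set y := z - 2^-1 *: (a + b); set y' := z' - 2^-1 *: (a + b); move=> hy hy'.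
pose h := 2^-1 *: (b - a).
have hh : sqn h <= D ^+ 2 / 4.
  by rewrite sqnZ exprVn -natrX mulrC ler_pM2r // invr_gt0.
(* The tangent bound sqrt(D^2/4 + c) <= D/2 + c/D, stated without roots. It is applied to
   [z - a = h + y] and [b - z' = h - y'], and its first-order part produces the linear form. *)
have key (u : V) : sqn u <= r ->
  let c := 2 * dot h u + sqn u in
  0 <= D / 2 + c / D /\ sqn (h + u) <= (D / 2 + c / D) ^+ 2.
  move=> hu c; have := sqn_ge0 (h + u); rewrite sqnD => h1.
  have cD : - (D / 4) <= c / D.
    rewrite ler_pdivlMr //.
    have -> : - (D / 4) * D = - (D ^+ 2 / 4) by field.
    by rewrite /c; lra.
  split; first lra.
  have -> : (D / 2 + c / D) ^+ 2 = D ^+ 2 / 4 + c + (c / D) ^+ 2.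
    by field; rewrite gt_eqF.
  by have := sqr_ge0 (c / D); rewrite /c; lra.
have [k1 k2] := key _ hy.
have [] := key (- y'); first by rewrite sqnN.
rewrite sqnN dotC dotNl dotC => k3 k4.
have e1 : z - a = h + y.
  by apply/rowP => i; rewrite /y /h !mxE; lra.
have e2 : b - z' = h - y'.
  by apply/rowP => i; rewrite /y' /h !mxE; lra.
have F1 := hF a z _ k1; rewrite e1 in F1; have {}F1 := F1 k2.
have F2 := hF z' b _ k3; rewrite e2 in F2; have {}F2 := F2 k4.
have e3 : dot (z - z') ((s / D) *: (b - a)) = s * (2 * dot h y - 2 * dot h y') / D.
  have -> : b - a = 2 *: h by rewrite scalerA divff ?pnatr_eq0 // scale1r.
  have -> : z - z' = y - y' by apply/rowP => i; rewrite /y /y' /h !mxE; lra.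
  rewrite dotC scalerA dotZl dotC dotDl dotNl !(dotC _ h).
  by field; rewrite gt_eqF.
rewrite e3.
set p := dot h y in F1 F2 *; set p' := dot h y' in F1 F2 *.
have bound (u : V) : sqn u <= r -> 2 * dot h u <= D ^+ 2 / 4 + r.
  move=> hu; have := sqn_ge0 (h - u); rewrite sqnD sqnN dotC dotNl dotC; lra.
have b1 := bound _ hy.
have b2 : - (2 * p') <= D ^+ 2 / 4 + r.
  by have := bound (- y'); rewrite sqnN dotC dotNl dotC => /(_ hy'); rewrite mulrN.
(* The growth from [a] to [z] and from [z'] to [b] is bounded above, that from [a] to [b] below; the
   three bounds are added after multiplication by [D]. *)
have F3 : (F z - F z' - s * (2 * p - 2 * p') / D - 1 - 2 * C) * D <=
    delta * D ^+ 2 + s * (sqn y + sqn y') + delta * (2 * p - 2 * p' + sqn y + sqn y').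
  have F1' : (F z - F a - C) * D <= (s + delta) * (D ^+ 2 / 2 + (2 * p + sqn y)).
    have -> : (s + delta) * (D ^+ 2 / 2 + (2 * p + sqn y)) =
      (s + delta) * (D / 2 + (2 * p + sqn y) / D) * D by field; rewrite gt_eqF.
    by rewrite ler_pM2r //; lra.
  have F2' : (F b - F z' - C) * D <= (s + delta) * (D ^+ 2 / 2 + (2 * - p' + sqn y')).
    have -> : (s + delta) * (D ^+ 2 / 2 + (2 * - p' + sqn y')) =
      (s + delta) * (D / 2 + (2 * - p' + sqn y') / D) * D by field; rewrite gt_eqF.
    by rewrite ler_pM2r //; lra.
  have hs' : (s * D - 1) * D <= (F b - F a) * D by rewrite ler_pM2r.
  have -> : (F z - F z' - s * (2 * p - 2 * p') / D - 1 - 2 * C) * D =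
    (F z - F z' - 1 - 2 * C) * D - s * (2 * p - 2 * p') by field; rewrite gt_eqF.
  lra.
have F4 : delta * (2 * p - 2 * p' + sqn y + sqn y') <= delta * (D ^+ 2 / 2 + 4 * r).
  by apply: ler_wpM2l => //; rewrite /p; lra.
have F5 : s * (sqn y + sqn y') <= s * (2 * r) by apply: ler_wpM2l => //; lra.
have F6 : 0 <= delta * D ^+ 2 by rewrite mulr_ge0 // exprn_ge0 // ltW.
rewrite -(ler_pM2r D0).
have -> : (1 + 2 * C + 2 * delta * D + (2 * s + 4 * delta) * r / D) * D =
  (1 + 2 * C) * D + 2 * delta * D ^+ 2 + (2 * s + 4 * delta) * r by field; rewrite gt_eqF.
lra.
Qed.

(* S D, the maximal increment of F over Euclidean distance D, is subadditive
   because F is defined on the whole space, so s D <= S D <= s D + o(D) with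
   s = inf S D / D. *)
Lemma extremal_slope (F : V -> R) (C1 : R) :
  (forall z z', `|F z - F z'| <= C1 * (`|z - z'| + 1)) ->
  exists s, [/\ 0 <= s,
    (forall D, 0 < D -> exists a b, sqn (b - a) <= D ^+ 2 /\ s * D - 1 <= F b - F a)
  & forall delta, 0 < delta -> exists C, forall u v (e : R), 0 <= e ->
      sqn (v - u) <= e ^+ 2 -> F v - F u <= (s + delta) * e + C].
Proof.
move=> hF.
have C10 : 0 <= C1.
  have := hF 0 0; rewrite !subrr !normr0 add0r mulr1 //.
pose E D := [set y : R | exists a b, sqn (b - a) <= D ^+ 2 /\ y = F b - F a].
have E0 D : 0 <= D -> E D 0.
  move=> D0; exists 0, 0; rewrite !subrr; split => //.
  by rewrite /sqn big1 ?sqr_ge0 // => i _; rewrite mxE expr0n.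
have ubE D : 0 <= D -> has_ubound (E D).
  move=> D0; exists (C1 * (D + 1)) => _ [a [b [ab ->]]].
  apply: le_trans (ler_norm _) (le_trans (hF _ _) _).
  rewrite ler_wpM2l // lerD2r -ler_sqr ?nnegrE //.
  exact: le_trans (norm_sqn _) ab.
have supE D : 0 <= D -> has_sup (E D).
  by move=> D0; split; [exists 0; exact: E0|exact: ubE].
pose S D := sup (E D).
have SE D a b : 0 <= D -> sqn (b - a) <= D ^+ 2 -> F b - F a <= S D.
  by move=> D0 ab; apply: ub_le_sup; [exact: ubE|exists a, b].
pose Q := [set q : R | exists2 D, 0 < D & q = S D / D].
have S0 D : 0 <= D -> 0 <= S D.
  by move=> D0; apply: ub_le_sup; [exact: ubE|exact: E0].
have hQ : has_inf Q.
  split; first by exists (S 1 / 1), 1.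
  by exists 0 => _ [D D0 ->]; rewrite divr_ge0 ?S0 // ltW.
exists (inf Q); split.
- by apply: lb_le_inf => [|_ [D D0 ->]]; [case: hQ|rewrite divr_ge0 ?S0 // ltW].
- move=> D D0; have := @sup_adherent _ (E D) 1 ltr01 (supE _ (ltW D0)).
  move=> [_ [a [b [ab ->]]] h]; exists a, b; split => //.
  apply: ltW; apply: le_lt_trans h; rewrite lerD2r -ler_pdivlMr //.
  by apply: ge_inf; [case: hQ|exists D].
move=> delta delta0.
have [_ [D D0 ->] h] := @inf_adherent _ Q delta delta0 hQ.
(* Here [S D / D] is within [delta] of the infimum. The segment is cut into floor(e/D) + 1 steps of
   length at most [D], and the constant pays for the surplus step. *)
exists ((inf Q + delta) * D) => u v e e0 uv.
pose n := (Num.truncn (e / D)).+1.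
have n0 : 0 < n%:R :> R by rewrite ltr0n.
have /andP[le_n lt_n] := truncn_itv (divr_ge0 e0 (ltW D0)).
pose w := n%:R^-1 *: (v - u).
have hw : sqn w <= D ^+ 2.
  rewrite sqnZ; apply: le_trans (_ : (n%:R^-1 ^+ 2) * e ^+ 2 <= _).
    by rewrite ler_wpM2l // sqr_ge0.
  rewrite -exprMn ler_sqr ?nnegrE ?(ltW D0) //; last first.
    by rewrite mulr_ge0 // invr_ge0 ltW.
  by rewrite mulrC ler_pdivrMr // mulrC -ler_pdivrMr // ltW.
have ew : u + n%:R *: w = v.
  by rewrite scalerA divff ?gt_eqF // scale1r addrC subrK.
have : F v - F u <= n%:R * S D.
  have step a : F (a + w) - F a <= S D.
    have -> : a + w = w + a by rewrite addrC.
    apply: SE; first exact: ltW D0.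
    rewrite addrK; exact: hw.
  have := telescope_ub F w (S D) step n u.
  by rewrite ew.
move=> /le_trans; apply.
apply: le_trans (_ : (e / D + 1) * ((inf Q + delta) * D) <= _).
  apply: ler_pM => //; [exact: S0 (ltW D0)|by rewrite -natr1 lerD2r|].
  by rewrite -ler_pdivrMr // ltW.
rewrite mulrDl mul1r lerD2r mulrC -mulrA [D * _]mulrC divfK ?gt_eqF //.
Qed.

(** The ball of radius [rho] sits at the midpoint of an almost extremal pair at distance at most
    [K * rho]. Each source of error gets a third of [eps * rho]: a large [K] controls the quadratic
    term, [delta] then absorbs the excess slope, and the lower bound on [rho] absorbs the
    constants. *)
Lemma near_linear_balls (F : V -> R) (C1 : R) :
  (forall z z', `|F z - F z'| <= C1 * (`|z - z'| + 1)) ->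
  forall eps : R, 0 < eps -> exists rho0 : R, forall rho, rho0 <= rho ->
    exists (z0 g : V), forall z z', `|z - z0| <= rho -> `|z' - z0| <= rho ->
      `|F z - F z' - dot (z - z') g| <= eps * rho.
Proof.
move=> /extremal_slope[s [s0 hlow hup]] eps eps0.
pose K := 1 + 3 * (2 * s + 4) * d%:R / eps.
have K1 : 1 <= K by rewrite lerDl divr_ge0 ?(ltW eps0) // !mulr_ge0 //; lra.
have K0 : 0 < K by apply: lt_le_trans K1.
pose delta := Num.min 1 (eps / (6 * K)).
have delta0 : 0 < delta by rewrite lt_min ltr01 divr_gt0 // mulr_gt0.
have [C hC] := hup _ delta0.
have C0 : 0 <= C.
  have := hC 0 0 0 (lexx _); rewrite !subrr mulr0 add0r; apply.
  by rewrite /sqn big1 ?sqr_ge0 // => i _; rewrite mxE expr0n.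
exists (1 + 3 * (1 + 2 * C) / eps) => rho hrho.
have rho0 : 0 < rho.
  by apply: lt_le_trans hrho; rewrite ltr_pwDl // divr_ge0 ?(ltW eps0) //; lra.
have D0 : 0 < K * rho by rewrite mulr_gt0.
have [a [b [ab Fab]]] := hlow _ D0.
exists (2^-1 *: (a + b)), ((s / (K * rho)) *: (b - a)).
pose r := d%:R * rho ^+ 2.
have hr0 : 0 <= r by rewrite mulr_ge0 // sqr_ge0.
have hr z : `|z - 2^-1 *: (a + b)| <= rho -> sqn (z - 2^-1 *: (a + b)) <= r.
  move=> h; apply: le_trans (sqn_norm _) _; rewrite ler_wpM2l //.
  by rewrite ler_sqr ?nnegrE // ltW.
have final : 1 + 2 * C + 2 * delta * (K * rho) + (2 * s + 4 * delta) * r / (K * rho)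
    <= eps * rho.
  have f1 : 1 + 2 * C <= eps * rho / 3.
    have : 3 * (1 + 2 * C) / eps <= rho by lra.
    by rewrite ler_pdivrMr //; lra.
  have f2 : 2 * delta * (K * rho) <= eps * rho / 3.
    have : delta <= eps / (6 * K) by rewrite ge_min lexx orbT.
    rewrite ler_pdivlMr ?mulr_gt0 // => h.
    have := ler_wpM2r (ltW rho0) h; lra.
  have f3 : (2 * s + 4 * delta) * r / (K * rho) <= eps * rho / 3.
    have d1 : delta <= 1 by rewrite ge_min lexx.
    apply: le_trans (_ : (2 * s + 4) * r / (K * rho) <= _).
      by rewrite ler_wpM2r ?invr_ge0 ?(ltW D0) // ler_wpM2r //; lra.
    rewrite ler_pdivrMr // /r.
    have : 3 * (2 * s + 4) * d%:R <= eps * K.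
      have -> : eps * K = eps + 3 * (2 * s + 4) * d%:R by rewrite /K; field; rewrite gt_eqF.
      by rewrite lerDr ltW.
    move=> h; have := ler_wpM2r (sqr_ge0 rho) h; lra.
  lra.
move=> z z' /hr hz /hr hz'; rewrite ler_norml; apply/andP; split.
  have := extremal_slope_near_linear F s delta C (K * rho) r a b z' z s0
    (ltW delta0) D0 hr0 hC ab Fab hz' hz.
  rewrite -(opprB z z') dotNl; lra.
have := extremal_slope_near_linear F s delta C (K * rho) r a b z z' s0
    (ltW delta0) D0 hr0 hC ab Fab hz hz'.
lra.
Qed.

End AsymptoticallyLinearBalls.
Arguments dot {R d} u v.
Arguments dotC {R d} u v.
Arguments sqn_ge0 {R d} v.
Arguments norm_rV_ge {R d} v i.
Arguments telescope_ub {R d} F w B _ n a.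
Arguments near_linear_balls {R d F C1} _ [eps] _.

(** * Coordinates over the ring generated by the expansion constants *)

Section Coordinates.
Variables (R : realType) (N : nat) (theta : sym N -> R).
Local Notation O := (Zthetabar theta).

Lemma Zt_zero : O 0.
Proof. rewrite -(subrr 1); apply: Zt_add; [|apply: Zt_opp]; exact: Zt_one. Qed.

Lemma Zt_sub a b : O a -> O b -> O (a - b).
Proof. by move=> ha hb; apply: Zt_add => //; apply: Zt_opp. Qed.

Lemma Zt_sum (I : Type) (s : seq I) (P : pred I) (F : I -> R) :
  (forall i, P i -> O (F i)) -> O (\sum_(i <- s | P i) F i).
Proof. by move=> h; elim/big_ind: _ => //; [exact: Zt_zero|exact: Zt_add]. Qed.

Lemma Zt_prod (I : Type) (s : seq I) (P : pred I) (F : I -> R) :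
  (forall i, P i -> O (F i)) -> O (\prod_(i <- s | P i) F i).
Proof. by move=> h; elim/big_ind: _ => //; [exact: Zt_one|exact: Zt_mul]. Qed.

Lemma Zt_sign n : O ((-1) ^+ n).
Proof.
elim: n => [|n IH]; first by rewrite expr0; exact: Zt_one.
by rewrite exprS mulN1r; apply: Zt_opp.
Qed.

Lemma Zt_det n (A : 'M[R]_n) : (forall i j, O (A i j)) -> O (\det A).
Proof.
move=> h; apply: Zt_sum => s _; apply: Zt_mul; first exact: Zt_sign.
by apply: Zt_prod.
Qed.

Lemma Zt_adj n (A : 'M[R]_n) : (forall i j, O (A i j)) -> forall i j, O ((\adj A) i j).
Proof.
move=> h i j; rewrite mxE /cofactor; apply: Zt_mul.
  exact: Zt_sign.
by apply: Zt_det => k l; rewrite !mxE.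
Qed.

Section FreeCoordinates.
Variables (m d : nat) (g : 'M[R]_(m, d)).

Definition Zt_indep (S : {set 'I_m}) := forall c : 'rV[R]_m,
  (forall i, O (c ord0 i)) -> (forall i, i \notin S -> c ord0 i = 0) ->
  c *m g = 0 -> c = 0.

(** When [S] has maximal size, adjoining a row [k] creates a nontrivial relation, whose coefficient
    at [k] cannot vanish. That coefficient serves as the denominator [D], since it need not be
    invertible in the ring. *)
Lemma maximal_Zt_indep : exists2 S, Zt_indep S & forall k, exists D (c : 'rV[R]_m),
  [/\ O D, D != 0, (forall i, O (c ord0 i)), (forall i, i \notin S -> c ord0 i = 0)
    & D *: row k g = c *m g].
Proof.
have P0 : `[< Zt_indep finset.set0 >].
  apply/asboolP => c _ c0 _; apply/rowP => i; rewrite mxE c0 //; by rewrite inE.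
case: (@arg_maxnP _ finset.set0 (fun S => `[< Zt_indep S >]) (fun S => #|S|) P0)
  => S /asboolP iS maxS.
exists S => // k.
have [kS|kS] := boolP (k \in S).
  exists 1, (delta_mx ord0 k); split.
  - exact: Zt_one.
  - exact: oner_neq0.
  - by move=> i; rewrite mxE eqxx /=; case: eqP => _; [exact: Zt_one|exact: Zt_zero].
  - move=> i iS'; rewrite mxE eqxx /=; case: eqP => // ik.
    by move: iS'; rewrite ik kS.
  - by rewrite scale1r rowE.
have /asboolP nS : ~~ `[< Zt_indep (k |: S) >].
  apply/negP => /maxS; rewrite cardsU1 kS add1n /=; lia.
move: nS => /existsNP[c /not_implyP[cO /not_implyP[cS /not_implyP[cg c0]]]].
have ck : c ord0 k != 0.
  apply/eqP => ck; apply: c0; apply: iS => // i iS'.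
  have [->//|ik] := eqVneq i k; apply: cS.
  by rewrite !inE negb_or ik.
exists (c ord0 k), (c ord0 k *: delta_mx ord0 k - c); split => //.
- move=> i; rewrite !mxE eqxx /=; apply: Zt_sub => //; apply: Zt_mul => //.
  by case: eqP => _; [exact: Zt_one|exact: Zt_zero].
- move=> i iS'; rewrite !mxE eqxx /=; have [->|ik] := eqVneq i k.
    by rewrite mulr1 subrr.
  by rewrite mulr0 sub0r cS ?oppr0 // !inE negb_or ik.
- by rewrite mulmxBl cg subr0 -scalemxAl -rowE.
Qed.

(** [D] is the product of the denominators of all rows, and [U] consists of the vectors whose
    [D]-multiple is a ring combination of the independent rows [S]. Uniqueness of the coefficients
    makes [phi] additive and linear on [U]; outside [U] it takes the default value 0. *)
Lemma coordinates_exist :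
  exists (U : set 'rV[R]_d) (phi : 'rV[R]_d -> 'rV[R]_m) (D : R),
  [/\ D != 0, (forall k, U (row k g)),
    (forall u v, U u -> U v -> U (u - v) /\ phi (u - v) = phi u - phi v),
    (forall c u, O c -> U u -> U (c *: u) /\ phi (c *: u) = c *: phi u)
  & (forall u, U u -> (forall i, O (phi u ord0 i)) /\ D *: u = phi u *m g)].
Proof.
have [S iS hS] := maximal_Zt_indep.
pose den k (D : R) := exists c : 'rV[R]_m, [/\ O D, D != 0,
  (forall i, O (c ord0 i)), (forall i, i \notin S -> c ord0 i = 0)
  & D *: row k g = c *m g].
pose D_ k := xget 0 (den k).
have hD k : den k (D_ k) by have [D hk] := hS k; exact: (@xgetPex _ 0 (den k) (ex_intro _ D hk)).
pose D := \prod_k D_ k.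
have D0 : D != 0 by apply/prodf_neq0 => k _; have [c []] := hD k.
pose rep u (c : 'rV[R]_m) := [/\ (forall i, O (c ord0 i)),
  (forall i, i \notin S -> c ord0 i = 0) & D *: u = c *m g].
pose U := [set u | exists c, rep u c].
have repU u c c' : rep u c -> rep u c' -> c = c'.
  move=> [h1 h2 h3] [h1' h2' h3']; apply/eqP; rewrite -subr_eq0; apply/eqP.
  apply: iS; last by rewrite mulmxBl -h3 -h3' subrr.
    by move=> i; rewrite !mxE; exact: Zt_sub.
  by move=> i iS'; rewrite !mxE h2 // h2' // subrr.
pose phi u := xget 0 (rep u).
have phiP u : U u -> rep u (phi u) by move=> h; exact: xgetPex.
have repphi u c : rep u c -> phi u = c.
  by move=> h; apply: (repU u) => //; apply: phiP; exists c.
exists U, phi, D; split => //.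
- move=> k; have [c [h1 h2 h3 h4 h5]] := hD k.
  exists ((\prod_(j | j != k) D_ j) *: c); split.
  + move=> i; rewrite mxE; apply: Zt_mul => //; apply: Zt_prod => j _.
    by have [? []] := hD j.
  + by move=> i iS'; rewrite mxE h4 // mulr0.
  + by rewrite /D (bigD1 k) //= mulrC -scalerA h5 scalemxAl.
- move=> u v /phiP[u1 u2 u3] /phiP[v1 v2 v3].
  have r : rep (u - v) (phi u - phi v).
    split; last by rewrite scalerBr u3 v3 mulmxBl.
      by move=> i; rewrite !mxE; exact: Zt_sub.
    by move=> i iS'; rewrite !mxE u2 // v2 // subrr.
  by split; [exists (phi u - phi v)|exact: repphi].
- move=> c u cO /phiP[u1 u2 u3].
  have r : rep (c *: u) (c *: phi u).
    split; last by rewrite scalerA mulrC -scalerA u3 scalemxAl.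
      by move=> i; rewrite mxE; exact: Zt_mul.
    by move=> i iS'; rewrite mxE u2 // mulr0.
  by split; [exists (c *: phi u)|exact: repphi].
- by move=> u /phiP[].
Qed.

End FreeCoordinates.

(* Cramer's rule over the ring O provides the common denominator. *)
Lemma basis_of_real_relations (m d : nat) (g : 'M[R]_(m, d)) (D : R)
  (phi : 'rV[R]_d -> 'rV[R]_m) (L : set 'rV[R]_d) :
  D != 0 ->
  (forall v, L v -> (forall i, O (phi v ord0 i)) /\ D *: v = phi v *m g) ->
  (forall n (w : 'I_n -> 'rV[R]_d) (a : 'I_n -> R), (forall k, L (w k)) ->
     \sum_k a k *: w k = 0 -> \sum_k a k *: phi (w k) = 0) ->
  exists b : 'M[R]_d, b \in unitmx /\
    forall v, L v -> exists c : 'rV[R]_d, (forall i, O (c ord0 i)) /\ v = c *m b.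
Proof.
move=> D0 phiL rel.
(* [B] will be an invertible matrix with as many rows in [L] as possible. *)
pose nrows (B : 'M[R]_d) := #|[set i | `[< L (row i B) >]]%SET|.
pose P n := `[< exists2 B : 'M[R]_d, B \in unitmx & nrows B = n >].
have P0 : exists n, P n by exists (nrows 1%:M); apply/asboolP; exists 1%:M; rewrite ?unitmx1.
have Pb n : P n -> (n <= d)%N.
  by move=> /asboolP[B _ <-]; rewrite -[X in (_ <= X)%N]card_ord; exact: max_card.
case: (ex_maxnP P0 Pb) => n /asboolP[B uB nB] nmax.
pose S := [set i | `[< L (row i B) >]]%SET.
have LS i : i \in S -> L (row i B) by rewrite inE => /asboolP.
(* Exchange argument: if [v] had a nonzero coordinate along a row outside [L], replacing that row by
   [v] would keep [B] invertible and gain a row in [L]. *)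
have supp v : L v -> forall i, i \notin S -> (v *m invmx B) ord0 i = 0.
  move=> Lv i iS; apply/eqP/negPn/negP => ai.
  pose B' := \matrix_k (if k == i then v else row k B).
  have rB' k : row k B' = if k == i then v else row k B by rewrite rowK.
  have uB' : B' \in unitmx.
    rewrite -row_free_unit; apply: inj_row_free => u uB'0.
    have e : u *m B' = (u - u ord0 i *: delta_mx ord0 i + u ord0 i *: (v *m invmx B)) *m B.
      rewrite mulmxDl mulmxBl -!scalemxAl -mulmxA mulVmx // mulmx1 -rowE !mulmx_sum_row.
      rewrite (bigD1 i) //= rB' eqxx [in RHS](bigD1 i) //=.
      rewrite [_ + \sum_(_ | _) _ - _]addrAC subrr add0r addrC.
      by congr (_ + _); apply: eq_bigr => k /negPf ki; rewrite rB' ki.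
    have {}e : u - u ord0 i *: delta_mx ord0 i + u ord0 i *: (v *m invmx B) = 0.
      by rewrite -[LHS](mulmxK uB) -e uB'0 mul0mx.
    have ui : u ord0 i = 0.
      set q := v *m invmx B in ai e; clearbody q; have /rowP/(_ i) := e.
      rewrite !mxE !eqxx /= mulr1 subrr add0r => /eqP.
      by rewrite mulf_eq0 (negPf ai) orbF => /eqP.
    by move: e; rewrite ui !scale0r subr0 addr0.
  have : (n.+1 <= n)%N; last by rewrite ltnn.
  apply: leq_trans (nmax (nrows B') _); last by apply/asboolP; exists B'.
  rewrite -nB /nrows -/S -add1n -[1%N]/(true : nat) -iS -cardsU1 subset_leq_card //.
  apply/fintype.subsetP => k; rewrite !inE => /orP[/eqP ->|kS].
    by rewrite rB' eqxx.
  by rewrite rB'; case: eqP => // _; move: kS; rewrite ?asboolE.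
(* Rows in [S] carry their coordinates; the others are padded by unit vectors in a separate block,
   so that [W] has full row rank even if [L] does not span the space. *)
pose W : 'M[R]_(d, m + d) :=
  \matrix_i (if i \in S then row_mx (phi (row i B)) 0 else row_mx 0 (delta_mx ord0 i)).
have WO i j : O (W i j).
  have OB j' : O ((delta_mx ord0 i : 'rV[R]_d) ord0 j').
    by rewrite mxE; case: (_ && _); [exact: Zt_one|exact: Zt_zero].
  rewrite mxE; case: ifP => iS; rewrite mxE; case: fintype.split => j'.
  - exact: (proj1 (phiL _ (LS _ iS))).
  - by rewrite mxE; exact: Zt_zero.
  - by rewrite mxE; exact: Zt_zero.
  - exact: OB.
have relW (a : 'rV[R]_d) : a *m W = row_mx (\sum_(i in S) a ord0 i *: phi (row i B))
    (\sum_(i | i \notin S) a ord0 i *: delta_mx ord0 i).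
  rewrite mulmx_sum_row (bigID (mem S)) /=.
  rewrite (eq_bigr (fun i => row_mx (a ord0 i *: phi (row i B)) 0)); last first.
    by move=> i iS; rewrite rowK iS scale_row_mx scaler0.
  rewrite [X in _ + X](eq_bigr (fun i => row_mx 0 (a ord0 i *: delta_mx ord0 i))); last first.
    by move=> i /negPf iS; rewrite rowK iS scale_row_mx scaler0.
  have sumE (p : pred 'I_d) (F : 'I_d -> 'rV[R]_m) (G : 'I_d -> 'rV[R]_d) :
      \sum_(i | p i) row_mx (F i) (G i) = row_mx (\sum_(i | p i) F i) (\sum_(i | p i) G i).
    elim/big_rec3: _ => [|i x y z _ ->]; first by rewrite row_mx0.
    by rewrite add_row_mx.
  by rewrite !sumE add_row_mx !big1_eq addr0 add0r.
have freeW : row_free W.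
  apply: inj_row_free => a; rewrite relW => e.
  have [e1 e2] := eq_row_mx (etrans e (esym (row_mx0 _ _ _ _))).
  have a2 i : i \notin S -> a ord0 i = 0.
    move=> iS; have /rowP/(_ i) := e2.
    rewrite summxE (bigD1 i) //= big1 => [|k /andP[_ ki]]; rewrite !mxE !eqxx /=.
      by rewrite mulr1 addr0.
    by rewrite eq_sym (negPf ki) mulr0.
  have : a *m B = 0.
    apply: (scalerI D0); rewrite scaler0 mulmx_sum_row (bigID (mem S)) /=.
    rewrite [X in _ + X]big1 ?addr0; last by move=> i iS; rewrite a2 // scale0r.
    rewrite scaler_sumr -[RHS](mul0mx _ g) -e1 mulmx_suml.
    apply: eq_bigr => i iS; have [_ h] := phiL _ (LS _ iS).
    by rewrite scalerA mulrC -scalerA h scalemxAl.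
  by move=> /(congr1 (mulmx^~ (invmx B))); rewrite mulmxK // mul0mx.
have fWT : row_full W^T by rewrite /row_full mxrank_tr.
(* [f] selects [d] independent columns of [W]; they form the square matrix [Q] to which Cramer's
   rule applies. *)
pose f := fullrankfun fWT.
have uf : colsub f W \in unitmx.
  by rewrite -unitmx_tr trmx_mxsub; exact: fullrowsub_unit.
pose Q := colsub f W.
have QO i j : O (Q i j) by rewrite mxE.
have Q0 : \det Q != 0 by rewrite -unitfE -unitmxE.
exists ((\det Q)^-1 *: B); split.
  by rewrite unitmxZ // unitfE invr_eq0.
move=> v Lv; pose a := v *m invmx B.
have va : v = a *m B by rewrite mulmxKV.
have ra : \sum_(i in S) a ord0 i *: phi (row i B) = phi v.
  have e : v = \sum_(i in S) a ord0 i *: row i B.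
    rewrite [LHS]va mulmx_sum_row (bigID (mem S)) /= [X in _ + X]big1 ?addr0 //.
    by move=> i iS; rewrite supp // scale0r.
  (* The relation is [v = \sum a_i B_i]: index 0 holds [v] with coefficient -1, and indices outside
     [S] hold a dummy [v] with coefficient 0. *)
  have h := rel d.+1 (fun k => if unlift ord0 k is Some i then
      if i \in S then row i B else v else v)
    (fun k => if unlift ord0 k is Some i then
      if i \in S then a ord0 i else 0 else -1).
  have {h} : - phi v + \sum_(i in S) a ord0 i *: phi (row i B) = 0.
    rewrite -[RHS]h.
    - rewrite big_ord_recl unlift_none scaleN1r; congr (_ + _).
      rewrite big_mkcond; apply: eq_bigr => i _; rewrite liftK.
      by case: ifP => // iS; rewrite scale0r.
    - by move=> k; case: unliftP => // i _; case: ifP => // /LS.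
    - rewrite big_ord_recl unlift_none scaleN1r; apply/eqP; rewrite addrC subr_eq0; apply/eqP.
      rewrite [RHS]e [RHS]big_mkcond; apply: eq_bigr => i _; rewrite liftK.
      by case: ifP => // iS; rewrite scale0r.
  by move=> /eqP; rewrite addrC subr_eq0 => /eqP.
have aW : a *m W = row_mx (phi v) 0.
  rewrite relW ra; congr row_mx; rewrite big1 // => i iS; by rewrite supp // scale0r.
exists (colsub f (row_mx (phi v) 0) *m \adj Q); split.
  move=> i; rewrite mxE; apply: Zt_sum => j _; apply: Zt_mul; last exact: Zt_adj.
  rewrite mxE mxE; case: fintype.split => k; last by rewrite mxE; exact: Zt_zero.
  exact: (proj1 (phiL _ Lv)).
have <- : colsub f (a *m W) = colsub f (row_mx (phi v) 0) by rewrite aW.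
rewrite -mulmx_colsub.
have -> : a *m Q *m \adj Q = \det Q *: a by rewrite -mulmxA mul_mx_adj mul_mx_scalar.
by rewrite -scalemxAl -scalemxAr scalerA divff // scale1r.
Qed.

End Coordinates.
Arguments coordinates_exist {R N} theta {m d} g.
Arguments basis_of_real_relations {R N theta m d g D phi L} _ _ _.

(** * Chains of closed sets along a segment *)

Section SegmentChain.
Variables (R : realType) (d : nat).
Local Notation V := 'rV[R]_d.
Variables (I : choiceType) (Q : I -> set V) (T : I -> Prop) (Rel : nat -> I -> I -> Prop).
Hypothesis closedQ : forall i, T i -> closed (Q i).
Hypothesis Rel0 : forall i, T i -> Rel 0 i i.
Hypothesis RelS : forall n i j k y, T i -> T j -> T k -> Q i y -> Q j y ->
  Rel n j k -> Rel n.+1 i k.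

(** Stay with [i] up to the last parameter [t1] at which the segment lies in [Q i]. Past [t1] the
    segment never meets [Q i] again, so the induction goes on from [t1] with [i] struck from the
    list, whose length thus bounds the chain. *)
Lemma segment_chain_from (u w : V) (s : seq I) : (forall i, i \in s -> T i) ->
  forall t0 : R, 0 <= t0 <= 1 ->
  (forall r, t0 <= r <= 1 -> exists2 i, i \in s & Q i (u + r *: (w - u))) ->
  exists i j n, [/\ T i, T j, (n < size s)%N,
    Q i (u + t0 *: (w - u)) /\ Q j w & Rel n i j].
Proof.
pose g r := u + r *: (w - u).
have gcont : continuous (g : R -> V).
  move=> r; apply: cvgD; first exact: cvg_cst.
  apply: cvgZr_tmp; exact: cvg_id.
have [n] := ubnP (size s); elim: n s => // n IH s sn sT t0 /andP[t0_ge0 t0_le1] cov.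
have [i is_ Qi] := cov t0 (introT andP (conj (lexx _) t0_le1)).
pose E := [set r | t0 <= r <= 1 /\ Q i (g r)].
have Et0 : E t0 by split => //; rewrite lexx t0_le1.
have hE : has_sup E by split; [exists t0|exists 1 => r [/andP[]]].
have cE : closed E.
  have -> : E = `[t0, 1] `&` (g @^-1` Q i).
    by apply/seteqP; split => r; rewrite /E /= in_itv.
  apply: closedI; first exact: itv_closed.
  by move/continuous_closedP: gcont; apply; apply: closedQ; exact: sT.
pose t1 := sup E.
have Et1 : E t1.
  rewrite ((closure_id E).1 cE); apply: closure_sup; first by exists t0.
  by case: hE.
have t1_max r : t1 < r -> r <= 1 -> ~ Q i (g r).
  move=> t1r r1 Qr; have [/andP[t01 _] _] := Et1.
  have : r <= t1.
    by apply: ub_le_sup; [case: hE|split => //; rewrite r1 andbT (le_trans t01) // ltW].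
  by rewrite leNgt t1r.
have [/andP[t01 t1_le1] Qt1] := Et1.
have [e1|t1_lt1] := eqVneq t1 1.
  have Ti := sT _ is_.
  exists i, i, 0%N; split => //; [by case: (s) is_| |exact: Rel0].
  by split => //; move: Qt1; rewrite e1 /g scale1r addrC subrK.
have {}t1_lt1 : t1 < 1 by rewrite lt_neqAle t1_lt1.
pose s' := [seq j <- s | j != i].
have ss' : (size s' < size s)%N.
  rewrite size_filter -(count_predC (pred1 i) s) -[X in (X < _)%N]add0n ltn_add2r.
  by rewrite -has_count has_pred1.
have s's j : j \in s' -> j \in s by rewrite mem_filter => /andP[].
have cov' r : t1 < r <= 1 -> exists2 j, j \in s' & Q j (g r).
  move=> /andP[t1r r1]; have [|j js Qj] := cov r.
    by rewrite r1 andbT (le_trans t01) // ltW.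
  exists j => //; rewrite mem_filter js andbT; apply/eqP => ji.
  by apply: (t1_max _ t1r r1); rewrite -ji.
(* Parameters just after [t1] are covered by [s'], and a finite union of closed sets is closed; so
   the point at [t1] lies in a member of [s'] too, which gives the contact with [Q i]. *)
have cov1 : exists2 j, j \in s' & Q j (g t1).
  pose C := \big[setU/set0]_(j <- s') Q j.
  have CE y : C y <-> exists2 j, j \in s' & Q j y.
    by rewrite /C -[X in X y]bigcup_seq; split => -[j js Qj]; exists j.
  have cC : closed (g @^-1` C).
    move/continuous_closedP: gcont; apply; apply: closed_bigsetU => j js.
    by apply: closedQ; apply: sT; exact: s's.
  apply/CE; rewrite -[C (g t1)]/((g @^-1` C) t1) ((closure_id _).1 cC).
  move=> B /nbhs_ballP[e /= e0 hB]; exists (Num.min 1 (t1 + e / 2)).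
  have lt1 : t1 < Num.min 1 (t1 + e / 2).
    by rewrite lt_min t1_lt1 ltrDl divr_gt0.
  have le1 : Num.min 1 (t1 + e / 2) <= 1 by rewrite ge_min lexx.
  split; first by apply/CE/cov'; rewrite lt1 le1.
  apply: hB; rewrite -ball_normE /= distrC ger0_norm ?subr_ge0 ?ltW //.
  rewrite ltrBlDl; apply: le_lt_trans (_ : t1 + e / 2 < _); first by rewrite ge_min lexx orbT.
  by rewrite ltrD2l; lra.
have [] := IH s' _ _ t1.
- exact: leq_trans ss' _.
- by move=> j /s's /sT.
- by rewrite t1_le1 andbT (le_trans t0_ge0).
- move=> r /andP[]; rewrite le_eqVlt => /orP[/eqP <- _|t1r r1]; first exact: cov1.
  by apply: cov'; rewrite t1r r1.
move=> j [k [p [Tj Tk ps [Qj Qk] R_]]].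
exists i, k, p.+1; split => //; first exact: sT.
  exact: leq_ltn_trans ps ss'.
by apply: RelS R_; [exact: sT|exact: Tj| exact: Tk|exact: Qt1|exact: Qj].
Qed.

Lemma segment_chain (u w : V) (s : seq I) : (forall i, i \in s -> T i) ->
  (forall r : R, 0 <= r <= 1 -> exists2 i, i \in s & Q i (u + r *: (w - u))) ->
  exists i j n, [/\ T i, T j, (n < size s)%N, Q i u /\ Q j w & Rel n i j].
Proof.
move=> sT cov.
have [] := segment_chain_from u w s sT 0 _ cov; first by rewrite lexx ler01.
by move=> i [j [n]]; rewrite scale0r addr0 => h; exists i, j, n.
Qed.

End SegmentChain.
Arguments segment_chain {R d I Q T Rel} _ _ _ u w [s] _ _.

(** * Supertiles, their supports and their scales *)

Section Supertiles.
Variables (R : realType) (d M N : nat).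
Local Notation V := 'rV[R]_d.
Variables (t : 'I_M -> set V) (theta : sym N -> R)
  (kappa : sym N -> 'I_M -> 'I_M -> nat) (tau : sym N -> 'I_M -> 'I_M -> nat -> V)
  (x : Sigma N).
Local Notation tile := (tile R d M).
Local Notation c := (cexp theta x).

(* The level-m supertiles composing the level-(m+k) supertile of type i; a pair
   (j, p) stands for the level-m supertile of type j translated by p. *)
Fixpoint superpatch (m k : nat) (i : 'I_M) : set tile :=
  match k with
  | 0 => [set (i, 0)]
  | k'.+1 => fun tl => exists (j : 'I_M) (l : nat),
      (l < kappa (xc x (m + k'.+1)%N%:Z) i j)%N /\
      superpatch m k' j
        (tl.1, tl.2 - c (m + k'.+1)%N *: tau (xc x (m + k'.+1)%N%:Z) i j l)
  end.

(** The region occupied by a level-[m] supertile, given as an inflated prototile instead of a union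
    of tiles. *)
Definition stile (m : nat) (tl : tile) : set V :=
  [set z | exists2 a, t tl.1 a & z = c m *: a + tl.2].

Lemma superpatch0 k i tl : supertile theta kappa tau x k i tl <-> superpatch 0 k i tl.
Proof.
elim: k i tl => [//|k IH] i tl.
by split=> -[j [l [lk /IH h]]]; exists j, l.
Qed.

Lemma superpatch_cat m a b i j p j' p' :
  superpatch (m + a) b i (j', p') -> superpatch m a j' (j, p) ->
  superpatch m (a + b) i (j, p + p').
Proof.
elim: b i p' => [|b IH] i p' /=.
  by move=> [-> ->]; rewrite addr0 addn0.
move=> [i' [l [lk h]]] h2; rewrite addnS /=; exists i', l.
have -> : (m + (a + b).+1 = m + a + b.+1)%N by lia.
by split => //; rewrite -addrA; exact: IH h2.
Qed.

Lemma cexp0 : c 0%N = 1.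
Proof. by rewrite /cexp big_geq. Qed.

Lemma cexpS m : c m.+1 = c m * (theta (xc x m.+1%:Z))^-1.
Proof. by rewrite /cexp big_nat_recr. Qed.

Lemma stile0 tl : stile 0 tl = tile_set t tl.
Proof.
apply/seteqP; split => z /=.
  by move=> [a ta ->]; exists a => //; rewrite cexp0 scale1r.
by move=> [a ta <-]; exists a => //; rewrite cexp0 scale1r.
Qed.

Lemma stile_transl m j p z w : stile m (j, p) z -> stile m (j, p + w) (z + w).
Proof. by move=> [a ta ->]; exists a => //; rewrite addrA. Qed.

Lemma stile_shift m j p z : stile m (j, p) z <-> stile m (j, 0) (z - p).
Proof.
split=> [/(@stile_transl _ _ _ _ (- p))|/(@stile_transl _ _ _ _ p)].
  by rewrite subrr.
by rewrite add0r subrK.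
Qed.

Hypothesis subst : forall l, substitution_rule t theta kappa tau l.

Lemma theta_gt0 l : 0 < theta l.
Proof. by have [/andP[]] := subst l. Qed.

Lemma cexp_gt0 m : 0 < c m.
Proof.
elim: m => [|m IH]; first by rewrite cexp0.
by rewrite cexpS mulr_gt0 // invr_gt0 theta_gt0.
Qed.

Lemma cexp_Zt m : Zthetabar theta (c m).
Proof.
elim: m => [|m IH]; first by rewrite cexp0; exact: Zt_one.
by rewrite cexpS; apply: Zt_mul => //; exact: Zt_gen.
Qed.

(** Finitely many rules leave a common margin [q] between 1 and their expansion constants; the
    growth is then Bernoulli's inequality. *)
Lemma cexp_unbounded : exists2 q : R, 0 < q & forall m, 1 + m%:R * q <= c m.
Proof.
pose q := \big[Num.min/1]_(l < N.+1) ((theta l)^-1 - 1).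
have q0 : 0 < q.
  apply: lt_bigmin => // l _; rewrite subr_gt0 invf_gt1 ?theta_gt0 //.
  by have [/andP[]] := subst l.
have ql l : 1 + q <= (theta l)^-1 by rewrite -lerBrDl; exact: bigmin_le_cond.
exists q => //; elim=> [|m IH]; first by rewrite cexp0 mul0r addr0.
rewrite cexpS; apply: le_trans (_ : (1 + m%:R * q) * (1 + q) <= _).
  rewrite -natr1; have : 0 <= m%:R * q * q by rewrite !mulr_ge0 // ltW.
  lra.
apply: ler_pM => //; last by rewrite addr_ge0 // ltW.
by rewrite addr_ge0 // mulr_ge0 // ltW.
Qed.

Lemma stileS m i z : stile m.+1 (i, 0) z <-> exists j l,
  (l < kappa (xc x m.+1%:Z) i j)%N /\
  stile m (j, c m.+1 *: tau (xc x m.+1%:Z) i j l) z.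
Proof.
set l0 := xc x m.+1%:Z.
have [_ ht _] := subst l0.
have th0 := theta_gt0 l0.
have cm : c m = c m.+1 * theta l0 by rewrite cexpS -mulrA mulVf ?mulr1 // gt_eqF.
split.
- move=> [a]; rewrite /= ht => -[j [l [lk [_ [b tb <-] <-]]]] ->.
  exists j, l; split => //; exists b => //=.
  by rewrite addr0 scalerDr scalerA -cm.
- move=> [j [l [lk [b /= tb ->]]]]; exists (theta l0 *: b + tau l0 i j l).
    rewrite /= ht; exists j, l; split => //; exists (theta l0 *: b) => //.
    by exists b.
  by rewrite addr0 scalerDr scalerA -cm.
Qed.

Lemma superpatch_cover m k i z : stile (m + k) (i, 0) z ->
  exists2 tl, superpatch m k i tl & stile m tl z.
Proof.
elim: k i z => [|k IH] i z; first by rewrite addn0; exists (i, 0).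
rewrite addnS => /stileS[j [l [lk]]] /stile_shift /IH[[j' p] h hz].
exists (j', p + c (m + k).+1 *: tau (xc x (m + k).+1%:Z) i j l).
  by rewrite /= addnS; exists j, l; rewrite addrK.
by apply/stile_shift; rewrite opprD addrCA addrC -stile_shift.
Qed.

Lemma superpatch_sub m k i tl z : superpatch m k i tl -> stile m tl z ->
  stile (m + k) (i, 0) z.
Proof.
elim: k i tl z => [|k IH] i [j' p] z; first by rewrite addn0 /= => ->.
rewrite /= addnS => -[j [l [lk h]]] hz; apply/stileS; exists j, l; split => //.
apply/stile_shift; apply: IH h _; exact: stile_transl.
Qed.

(** Disjointness of interiors, phrased with balls so that it passes easily to translates and
    rescalings. *)
Definition no_common_ball (A B : set V) := forall z (e : R), 0 < e ->
  ~ (forall y, `|y - z| < e -> A y /\ B y).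

(** Descend from the top level. Two supertiles in the same piece of the first subdivision are
    handled by induction; those in different pieces inherit, after rescaling, the disjoint interiors
    of the pieces. *)
Lemma superpatch_disj m k i tl tl' : superpatch m k i tl -> superpatch m k i tl' ->
  tl <> tl' -> no_common_ball (stile m tl) (stile m tl').
Proof.
elim: k i tl tl' => [|k IH] i [j p] [j' p']; first by move=> /= -> ->.
move=> /= [i1 [l1 [lk1 h1]]] [i2 [l2 [lk2 h2]]] ne z e e0 hb.
have [e12|ne12] := pselect ((i1, l1) = (i2, l2)).
  case: e12 lk2 h2 => <- <- _ h2.
  set s := c _ *: _ in h1 h2.
  apply: (IH _ _ _ h1 h2 _ (z - s) _ e0) => [[e1 /addIr e2]|y hy].
    by apply: ne; rewrite e1 e2.
  have := hb (y + s); rewrite -(addrA y) -[s - z]opprB => /(_ hy)[k1 k2].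
  by rewrite -(addrK s y); split; exact: stile_transl.
have sub j0 l0 jp : (l0 < kappa (xc x (m + k).+1%:Z) i j0)%N ->
    superpatch m k j0 (jp.1, jp.2 - c (m + k).+1 *: tau (xc x (m + k).+1%:Z) i j0 l0) ->
    stile m jp `<=` [set y | piece t theta tau (xc x (m + k).+1%:Z) i j0 l0 ((c (m + k).+1)^-1 *: y)].
  move=> lk0 h y hy.
  have : stile (m + k) (j0, 0) (y - c (m + k).+1 *: tau (xc x (m + k).+1%:Z) i j0 l0).
    by apply: superpatch_sub h _; apply: stile_transl; case: jp hy.
  move=> [a ta]; rewrite addr0 => /eqP; rewrite subr_eq => /eqP ->.
  have cn0 : c (m + k).+1 != 0 by rewrite gt_eqF // cexp_gt0.
  exists (theta (xc x (m + k).+1%:Z) *: a); first by exists a.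
  rewrite scalerDr !scalerA mulVf // scale1r; congr (_ *: _ + _).
  have cmk0 : c (m + k) != 0 by rewrite gt_eqF // cexp_gt0.
  by rewrite cexpS invfM invrK mulrAC mulVf // mul1r.
rewrite addnS in lk1 h1 lk2 h2.
have [_ _ disj] := subst (xc x (m + k).+1%:Z).
have h0 := disj i i1 l1 i2 l2 lk1 lk2 ne12.
have c0 := cexp_gt0 (m + k).+1.
have ngh A : (forall y, `|y - z| < e -> A ((c (m + k).+1)^-1 *: y)) ->
    @interior V A ((c (m + k).+1)^-1 *: z).
  move=> hA; apply/nbhs_ballP.
  exists ((c (m + k).+1)^-1 * e); first by rewrite /= mulr_gt0 // invr_gt0.
  move=> p1; rewrite -ball_normE /=.
  have [w ->] : exists w, p1 = (c (m + k).+1)^-1 *: w.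
    by exists (c (m + k).+1 *: p1); rewrite scalerA mulVf ?scale1r // gt_eqF.
  rewrite -scalerBr normrZ gtr0_norm ?invr_gt0 // ltr_pM2l ?invr_gt0 // distrC.
  exact: hA.
suff : @set0 V ((c (m + k).+1)^-1 *: z) by [].
rewrite -h0; split; apply: ngh => p1 hp1; have [k1 k2] := hb p1 hp1.
  exact: (sub _ _ (j, p) lk1 h1).
exact: (sub _ _ (j', p') lk2 h2).
Qed.

End Supertiles.
Arguments superpatch {R d M N} theta kappa tau x m k i _.
Arguments stile {R d M N} t theta x m tl _.
Arguments no_common_ball {R d} A B.
Arguments stile0 {R d M N} t theta x tl.
Arguments stile_transl {R d M N t theta x m j p z} w _.
Arguments superpatch_cat {R d M N theta kappa tau x m a b i j p j' p'} _ _.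
Arguments cexp_gt0 {R d M N t theta kappa tau x} _ m.
Arguments cexp_unbounded {R d M N t theta kappa tau x} _.
Arguments cexp_Zt {R N} theta x m.
Arguments superpatch_cover {R d M N t theta kappa tau x} _ [m k i z] _.
Arguments superpatch_sub {R d M N t theta kappa tau x} _ [m k i tl z] _ _.
Arguments superpatch_disj {R d M N t theta kappa tau x} _ [m k i tl tl'] _ _ _.

(** Supplies the completeness behind the use of Baire's theorem in [tiles_contain_balls]. *)
HB.instance Definition _ (R : realType) (d : nat) := Complete.on 'rV[R]_d.

Lemma affine_continuous (R : realType) (W : normedModType R) (k : R) (p : W) :
  continuous (fun a : W => k *: a + p).
Proof. by move=> a; apply: cvgD; [exact: scaler_continuous|exact: cvg_cst]. Qed.

(** * Finiteness of the set of adjacency vectors *)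

Section FiniteLocalComplexity.
Variables (R : realType) (d M N : nat).
Local Notation V := 'rV[R]_d.

Lemma compact_norm_bound (B : set V) : compact B -> exists r : R, forall b, B b -> `|b| <= r.
Proof.
move=> /compact_bounded[r [_ /(_ (r + 1))]]; rewrite ltrDl ltr01 => /(_ isT) h.
by exists (r + 1) => b /h.
Qed.

(** If the translates agree, adding [w - v] maps [B] into itself, so all multiples of [w - v] stay
    in a bounded set. *)
Lemma transl_inj (B : set V) v w : B !=set0 -> compact B ->
  transl B v = transl B w -> v = w.
Proof.
move=> [b Bb] /compact_norm_bound[r hr] e.
have step a : B a -> B (a + (w - v)).
  move=> Ba; have : transl B w (a + w) by exists a.
  by rewrite -e => -[a' Ba' e']; rewrite addrA -e' addrK.
have Bn n : B (b + n%:R *: (w - v)).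
  elim: n => [|n IH]; first by rewrite scale0r addr0.
  by rewrite -natr1 scalerDl scale1r addrA; exact: step.
apply/eqP; rewrite eq_sym -subr_eq0 -normr_le0; apply/negPn/negP; rewrite -ltNge => n0.
pose n := (Num.truncn ((r + `|b|) / `|w - v|)).+1.
have rb : 0 <= r + `|b| by rewrite addr_ge0 // (le_trans _ (hr _ Bb)).
have /andP[_] := truncn_itv (divr_ge0 rb (normr_ge0 (w - v))).
rewrite ltNge => /negP; apply.
rewrite ler_pdivlMr // -[X in X * _]ger0_norm // -normrZ.
have -> : n%:R *: (w - v) = (b + n%:R *: (w - v)) - b by rewrite [RHS]addrC addKr.
by apply: le_trans (ler_normB _ _) _; rewrite lerD2r; exact: hr.
Qed.

Variables (t : 'I_M -> set V) (theta : sym N -> R)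
  (kappa : sym N -> 'I_M -> 'I_M -> nat) (tau : sym N -> 'I_M -> 'I_M -> nat -> V).

(** Distinct touching tiles share a cell. By [transl_inj] the two matching prototile cells determine
    the difference of positions, and there are finitely many pairs of cells. *)
Lemma finite_adjacency : compatible t theta kappa tau ->
  exists K (g : 'M[R]_(K, d)), forall y k i (tl tl' : tile R d M) z,
    supertile theta kappa tau y k i tl -> supertile theta kappa tau y k i tl' ->
    tile_set t tl z -> tile_set t tl' z -> exists r, tl'.2 - tl.2 = row r g.
Proof.
move=> [ncell [cell [hcell hcompat]]].
pose Kc := \max_i ncell i.
(* [None] serves the case of two equal tiles; pairs of cells that are not translates of each other
   get the default 0. *)
pose vec (a : option (('I_M * 'I_Kc) * ('I_M * 'I_Kc))) : V := match a with
  | Some (ic, ic') => xget 0 [set v | cell ic.1 ic.2 = transl (cell ic'.1 ic'.2) v]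
  | None => 0 end.
exists #|{: option (('I_M * 'I_Kc) * ('I_M * 'I_Kc))}|, (\matrix_r vec (enum_val r)).
move=> y k i tl tl' z htl htl' tz tz'.
suff : exists a, tl'.2 - tl.2 = vec a.
  by move=> [a ->]; exists (enum_rank a); rewrite rowK enum_rankK.
have [<-|ne] := pselect (tl = tl'); first by exists None; rewrite subrr.
have : (tile_set t tl `&` tile_set t tl') z by [].
rewrite (hcompat y k i tl tl' htl htl' ne) => -[c [c' [hc hc' e _]]].
have ltK (j : 'I_M) (a : nat) : (a < ncell j)%N -> (a < Kc)%N.
  by move=> /leq_trans; apply; exact: leq_bigmax.
exists (Some ((tl.1, Ordinal (ltK _ _ hc)), (tl'.1, Ordinal (ltK _ _ hc')))) => /=.
have e2 : cell tl.1 c = transl (cell tl'.1 c') (tl'.2 - tl.2).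
  apply/seteqP; split => b.
    move=> cb; have : transl (cell tl.1 c) tl.2 (b + tl.2) by exists b.
    by rewrite e => -[b' cb' e']; exists b' => //; rewrite addrA e' addrK.
  move=> [b' cb' <-]; have : transl (cell tl'.1 c') tl'.2 (b' + tl'.2) by exists b'.
  by rewrite -e => -[a ca e']; rewrite addrA -e' addrK.
case: xgetP => [v _ /= hv|/(_ (tl'.2 - tl.2))]; last by [].
have [ne0 cpt _] := hcell tl'.1 c' hc'.
by apply: (transl_inj (cell tl'.1 c')) => //; rewrite -e2 -hv.
Qed.

End FiniteLocalComplexity.
Arguments compact_norm_bound {R d B} _.
Arguments finite_adjacency {R d M N t theta kappa tau} _.

(** * The hierarchy of supertiles in one tiling *)

Section BuiltTiling.
Variables (R : realType) (d M N : nat).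
Local Notation V := 'rV[R]_d.
Variables (t : 'I_M -> set V) (theta : sym N -> R)
  (kappa : sym N -> 'I_M -> 'I_M -> nat) (tau : sym N -> 'I_M -> 'I_M -> nat -> V)
  (x : Sigma N).
Local Notation tile := (tile R d M).
Local Notation c := (cexp theta x).
Local Notation superpatch := (superpatch theta kappa tau x).
Local Notation stile := (stile t theta x).

Hypothesis compact_t : forall i, @compact V (t i).
Hypothesis subst : forall l, substitution_rule t theta kappa tau l.
Let c0 m : 0 < c m := cexp_gt0 subst m.

Lemma closed_stile m tl : closed (stile m tl).
Proof.
apply: compact_closed; first exact: norm_hausdorff.
have -> : stile m tl = (fun a : V => c m *: a + tl.2) @` t tl.1.
  by apply/seteqP; split => z [a ta e]; exists a.
apply: continuous_compact; last exact: compact_t.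
apply: continuous_subspaceT; exact: affine_continuous.
Qed.

Lemma tile_norm_bound : exists2 D : R, 0 < D & forall j a, t j a -> `|a| <= D.
Proof.
pose D j := projT1 (cid (compact_norm_bound (compact_t j))).
have hD j a : t j a -> `|a| <= D j by exact: (projT2 (cid (compact_norm_bound (compact_t j)))).
exists (\big[Num.max/1]_j D j); first exact: lt_le_trans ltr01 (bigmax_ge_id _ _ _ _).
by move=> j a /hD /le_trans; apply; exact: le_bigmax.
Qed.

(** A positive entry of the product yields a path of positive multiplicities. [prodF] at [m.+1] and
    [k] has [k.+1] factors, with indices m+1 to m+k+1, whence the [k.+1] levels above [m]. *)
Lemma prodF_superpatch m k i j : 0 < prodF kappa x m.+1 k i j ->
  exists p, superpatch m k.+1 i (j, p).
Proof.
elim: k i => [|k IH] i /=.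
  rewrite mxE ltz_nat => hk; exists (c (m + 1) *: tau (xc x (m + 1)%N%:Z) i j 0%N).
  exists j, 0%N; split; first by rewrite addn1.
  by rewrite /= subrr.
rewrite mxE => hs.
have [i' hi'] : exists i', 0 < Fmx kappa (xc x (m.+1 + k.+1)%N%:Z) i i' * prodF kappa x m.+1 k i' j.
  apply: contrapT => /forallNP h; move: hs; rewrite ltNge => /negP; apply.
  by apply: sumr_le0 => i' _; rewrite leNgt; apply/negP => h'; exact: h h'.
move: hi'; rewrite [Fmx _ _ _ _]mxE.
case e: (kappa _ i i') => [|n]; first by rewrite mul0r ltxx.
rewrite pmulr_rgt0 // => /IH[p hp].
exists (p + c (m + k.+2)%N *: tau (xc x (m + k.+2)%N%:Z) i i' 0%N).
exists i', 0%N; rewrite addrK; split; last exact: hp.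
by move: e; rewrite addSnnS => ->.
Qed.

Hypothesis minimal_x : forall m : nat, (0 < m)%N ->
  exists n : nat, (m < n)%N /\ strictly_positive (prodF kappa x m (n - m)).

Lemma primitive_block m : exists L, forall i j, exists p, superpatch m L i (j, p).
Proof.
have [n [mn pos]] := minimal_x m.+1 isT.
by exists (n - m.+1).+1 => i j; exact: prodF_superpatch.
Qed.

Variables (ii : nat -> 'I_M) (vv : nat -> V).
Hypothesis nested : forall k, exists l, (l < kappa (xc x k.+1%:Z) (ii k.+1) (ii k))%N /\
   vv k = vv k.+1 + c k.+1 *: tau (xc x k.+1%:Z) (ii k.+1) (ii k) l.
Hypothesis covering : forall z, exists k tl,
  superpatch 0 k (ii k) (tl.1, tl.2 - vv k) /\ tile_set t tl z.

(** The tiling regrouped into level-[m] supertiles; [level 0] is the tiling itself. *)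
Definition level (m : nat) (tl : tile) : Prop :=
  exists k, superpatch m k (ii (m + k)) (tl.1, tl.2 - vv (m + k)).

Lemma level_mono m k n (tl : tile) :
  superpatch m k (ii (m + k)) (tl.1, tl.2 - vv (m + k)) ->
  superpatch m (k + n) (ii (m + (k + n))) (tl.1, tl.2 - vv (m + (k + n))).
Proof.
move=> h; elim: n => [|n IH]; first by rewrite addn0.
rewrite addnS /= addnS; have [l [lk e]] := nested (m + (k + n)).
exists (ii (m + (k + n))), l; split => //=.
by rewrite -addrA -opprD -e.
Qed.

Lemma level_common m tl tl' : level m tl -> level m tl' -> exists k,
  superpatch m k (ii (m + k)) (tl.1, tl.2 - vv (m + k)) /\
  superpatch m k (ii (m + k)) (tl'.1, tl'.2 - vv (m + k)).
Proof.
move=> [k h] [k' h']; exists (k + k')%N; split; first exact: level_mono.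
by rewrite addnC; exact: level_mono.
Qed.

Lemma level_superpatch m a i q j p : level (m + a) (i, q) -> superpatch m a i (j, p) ->
  level m (j, p + q).
Proof.
move=> [k /= h1] h2; exists (a + k)%N; rewrite /= addnA -addrA.
exact: superpatch_cat h1 h2.
Qed.

Lemma level_disj m tl tl' : level m tl -> level m tl' -> tl <> tl' ->
  no_common_ball (stile m tl) (stile m tl').
Proof.
case: tl tl' => [j p] [j' p'] h h' ne; have [k [/= hk hk']] := level_common _ _ _ h h'.
move=> z e e0 hb.
apply: (superpatch_disj subst hk hk' _ (z - vv (m + k)) e e0).
  by move=> [e1 /addIr e2]; apply: ne; rewrite e1 e2.
move=> y hy; have := hb (y + vv (m + k)).
rewrite -(addrA y) -[vv _ - z]opprB => /(_ hy)[k1 k2].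
by rewrite -(addrK (vv (m + k)) y); split; exact: stile_transl.
Qed.

Lemma covering_stile z : exists n0, forall n, (n0 <= n)%N -> stile n (ii n, vv n) z.
Proof.
have [k [tl [h hz]]] := covering z; exists k => n kn.
have := level_mono 0 k (n - k) tl h; rewrite !add0n subnKC // => {}h.
apply/stile_shift; apply: (superpatch_sub subst (m := 0) h).
by apply: stile_transl; rewrite stile0; case: tl hz h.
Qed.

Lemma level_cover m z : exists2 tl, level m tl & stile m tl z.
Proof.
have [n0 /(_ (m + n0)%N (leq_addl _ _))] := covering_stile z.
move=> /stile_shift /(superpatch_cover subst)[[j p] h hz].
exists (j, p + vv (m + n0)); first by exists n0; rewrite /= addrK.
by apply/stile_shift; rewrite opprD addrCA addrC -stile_shift.
Qed.

Lemma level_type m j : exists p, level m (j, p).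
Proof.
have [L hL] := primitive_block m; have [[i q] hi _] := level_cover (m + L) 0.
by have [p hp] := hL i j; exists (p + q); exact: level_superpatch hi hp.
Qed.

(** The space is a countable union of the closed supports of the nested supertiles, so by Baire one
    of them contains a ball. By primitivity its prototile occurs in a supertile of every type [j],
    and rescaling puts a ball into [t j]. *)
Lemma tiles_contain_balls : exists2 e : R, 0 < e &
  forall j, exists q, forall y, `|y - q| < e -> t j y.
Proof.
pose F k := ~` stile k (ii k, vv k).
have [k nd] : exists k, ~ dense (F k).
  apply: contrapT => /forallNP h.
  have oF k : open (F k) /\ dense (F k).
    split; first by apply: closed_openC; exact: closed_stile.
    by have := h k; rewrite not_notE.
  have [] := Baire oF (ex_intro setT 0 I) openT.
  move=> z [_ hz]; have [n0 hn0] := covering_stile z.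
  exact: (hz n0 I (hn0 n0 (leqnn _))).
have [W [[z Wz] [openW hW]]] : exists W : set V, W !=set0 /\ open W /\ ~ ((W `&` F k) !=set0).
  apply: contrapT => /forallNP h; apply: nd => W W0 openW.
  by apply: contrapT => hW; apply: (h W).
have /nbhs_ballP[e /= e0 hball] : nbhs z W by exact: open_nbhs_nbhs.
have inside y : `|y - z| < e -> stile k (ii k, vv k) y.
  move=> hy; apply: contrapT => hF; apply: hW; exists y; split => //.
  by apply: hball; rewrite -ball_normE /= distrC.
have [L hL] := primitive_block 0.
exists (e / (c k * c L)); first by rewrite divr_gt0 // mulr_gt0.
move=> j; have [p hp] := hL j (ii k).
exists ((c L)^-1 *: ((c k)^-1 *: (z - vv k) + p)) => y hy.
have nz m : c m != 0 by rewrite gt_eqF.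
have : stile k (ii k, vv k) (c k *: (c L *: y - p) + vv k).
  apply: inside; move: hy; rewrite ltr_pdivlMr ?mulr_gt0 //; apply: le_lt_trans.
  rewrite -[c k * c L]gtr0_norm ?mulr_gt0 // mulrC -normrZ le_eqVlt; apply/orP; left.
  apply/eqP; congr (`| _ |).
  by apply/rowP => i; rewrite !mxE; field; rewrite !nz.
move=> [a ta /addIr/(scalerI (nz k)) e1].
have : stile 0 (ii k, p) (c L *: y).
  by exists a => //; rewrite cexp0 scale1r -e1 subrK.
move=> /(superpatch_sub subst hp)[b tb].
by rewrite addr0 => /(scalerI (nz L)) ->.
Qed.

Lemma injective_code_seq (I : eqType) (C : finType) (f : I -> C) (S : I -> Prop) :
  (forall i j, S i -> S j -> f i = f j -> i = j) ->
  exists s : seq I, (size s <= #|C|)%N /\ forall i, i \in s <-> S i.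
Proof.
move=> inj.
pose g k := if pselect (exists i, S i /\ f i = k) is left h then Some (projT1 (cid h)) else None.
exists (pmap g (enum C)); split.
  by rewrite size_pmap (leq_trans (count_size _ _)) // -cardE.
move=> i; rewrite mem_pmap; split.
  move=> /mapP[k _]; rewrite /g; case: pselect => // h [->].
  by case: (projT2 (cid h)).
move=> Si; apply/mapP; exists (f i); first by rewrite mem_enum.
rewrite /g; case: pselect => [h|]; last by case; exists i.
by congr Some; have [S' e] := projT2 (cid h); apply: inj.
Qed.

(** Each level-[m] supertile contains a ball of radius [e * c m] and distinct ones share no ball, so
    their centres differ by at least [e * c m] in some coordinate. Rounding centres to this mesh is
    an injective code; all lengths scale with [c m], so [P] is independent of [m]. *)
Lemma level_packing (r : R) : 0 <= r -> exists P : nat, forall m z,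
  exists s : seq tile, [/\ (size s <= P)%N, (forall tl, tl \in s -> level m tl)
  & forall tl y, level m tl -> stile m tl y -> `|y - z| <= r * c m -> tl \in s].
Proof.
move=> r0; have [D D0 hD] := tile_norm_bound; have [e e0 he] := tiles_contain_balls.
pose q j := projT1 (cid (he j)).
have hq j y : `|y - q j| < e -> t j y by exact: (projT2 (cid (he j))).
have qD j : `|q j| <= D by apply: (hD j); apply: hq; rewrite subrr normr0.
pose b := (D + D + r) / e.
have b0 : 0 <= b by rewrite divr_ge0 ?(ltW e0) // !addr_ge0 // ltW.
pose K := Num.truncn (b + b).
exists #|{: 'I_M * {ffun 'I_d -> 'I_K.+1}}| => m z.
have cm := c0 m.
pose ctr (tl : tile) : V := c m *: q tl.1 + tl.2.
(* Mesh coordinates of the centre; adding [b] makes them nonnegative before truncation. *)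
pose co tl i := (ctr tl - z) ord0 i / (c m * e) + b.
pose S tl := level m tl /\ exists2 y, stile m tl y & `|y - z| <= r * c m.
have coP tl i : S tl -> 0 <= co tl i <= b + b.
  move=> [_ [_ [a ta ->] hy]].
  have : `|(ctr tl - z) ord0 i| <= b * (c m * e).
    apply: le_trans (norm_rV_ge _ _) _.
    have -> : ctr tl - z = c m *: (q tl.1 - a) + (c m *: a + tl.2 - z).
      by rewrite scalerBr !addrA subrK.
    apply: le_trans (ler_normD _ _) _; rewrite normrZ (gtr0_norm cm).
    have : c m * `|q tl.1 - a| <= c m * (D + D).
      rewrite ler_pM2l //; apply: le_trans (ler_normB _ _) _.
      by apply: lerD => //; exact: hD ta.
    have -> : b * (c m * e) = c m * (D + D) + r * c m.
      by rewrite /b; field; rewrite gt_eqF.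
    by move=> h1; apply: lerD.
  rewrite ler_norml => /andP[h1 h2].
  have ce0 : 0 < c m * e by rewrite mulr_gt0.
  rewrite /co; apply/andP; split; first by rewrite -lerBlDr sub0r ler_pdivlMr // mulNr.
  by rewrite lerD2r ler_pdivrMr.
pose f (tl : tile) : 'I_M * {ffun 'I_d -> 'I_K.+1} :=
  (tl.1, [ffun i => inord (Num.truncn (co tl i))]).
have inj tl tl' : S tl -> S tl' -> f tl = f tl' -> tl = tl'.
  move=> hS hS' [e1 /ffunP e2]; apply: contrapT => ne.
  have near : `|ctr tl - ctr tl'| < c m * e.
    have cod i : `|co tl i - co tl' i| < 1.
      have := e2 i; rewrite !ffunE => /(congr1 val) /=.
      have /andP[l1 u1] := coP _ i hS; have /andP[l2 u2] := coP _ i hS'.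
      rewrite !inordK ?ltnS ?le_truncn //.
      move=> e3; have /andP[a1 a2] := truncn_itv l1; have /andP[a3 a4] := truncn_itv l2.
      rewrite e3 -natr1 in a1 a2; rewrite -natr1 in a4; rewrite ltr_norml; lra.
    apply: norm_rV_lt => [|i]; first by rewrite mulr_gt0.
    have ce0 : 0 < c m * e by rewrite mulr_gt0.
    have := cod i; rewrite /co opprD addrACA subrr addr0 -mulrBl.
    have -> : (ctr tl - z) ord0 i - (ctr tl' - z) ord0 i = (ctr tl - ctr tl') ord0 i.
      by rewrite !mxE; lra.
    by rewrite normrM (gtr0_norm (_ : 0 < (c m * e)^-1)) ?invr_gt0 // ltr_pdivrMr // mul1r.
  have inside tl0 y : `|y - ctr tl0| < c m * e -> stile m tl0 y.
    move=> hy; exists ((c m)^-1 *: (y - tl0.2)).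
      apply: hq; rewrite -(ltr_pM2l cm) -[X in X * `|_|](gtr0_norm cm) -normrZ.
      rewrite scalerBr scalerA mulfV ?gt_eqF // scale1r.
      by rewrite -addrA -opprD [tl0.2 + _]addrC.
    by rewrite scalerA mulfV ?gt_eqF // scale1r subrK.
  have := level_disj _ _ _ (proj1 hS) (proj1 hS') ne (ctr tl) (c m * e - `|ctr tl - ctr tl'|).
  rewrite subr_gt0 => /(_ near); apply => y hy; split; apply: inside.
    by apply: lt_le_trans hy _; rewrite gerBl.
  have -> : y - ctr tl' = (y - ctr tl) + (ctr tl - ctr tl') by rewrite addrA subrK.
  by apply: le_lt_trans (ler_normD _ _) _; rewrite -ltrBrDr.
have [s [hs1 hs2]] := injective_code_seq _ _ f S inj.
exists s; split => //; first by move=> tl /hs2[].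
by move=> tl y h1 h2 h3; apply/hs2; split => //; exists y.
Qed.

(** * Repetition of the hierarchy at large scales *)

Hypothesis recurrent_x : forall k n0, exists n, (n0 <= n)%N /\
  forall j, (0 < j <= k)%N -> xc x (n + j)%N%:Z = xc x j%:Z.

Lemma recurrent_scale k (r : R) : exists n, r <= c n /\
  forall j, (0 < j <= k)%N -> xc x (n + j)%N%:Z = xc x j%:Z.
Proof.
have [q q0 hq] := cexp_unbounded (x := x) subst.
have [n [hn hrec]] := recurrent_x k (Num.truncn (`|r| / q)).+1.
exists n; split => //; apply: le_trans (hq n).
have /andP[_ /ltW] := truncn_itv (divr_ge0 (normr_ge0 r) (ltW q0)).
rewrite ler_pdivrMr // => h1; have h2 := ler_norm r.
have : (Num.truncn (`|r| / q)).+1%:R * q <= n%:R * q by rewrite ler_pM2r // ler_nat.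
by move: h1; set T := _.+1%:R * q; lra.
Qed.

Lemma cexp_recurrent n k : (forall j, (0 < j <= k)%N -> xc x (n + j)%N%:Z = xc x j%:Z) ->
  forall k', (k' <= k)%N -> c (n + k')%N = c n * c k'.
Proof.
move=> h; elim=> [|k' IH] kk; first by rewrite addn0 cexp0 mulr1.
by rewrite addnS !cexpS IH 1?ltnW // -addnS h ?mulrA.
Qed.

Lemma superpatch_recurrent n k : (forall j, (0 < j <= k)%N -> xc x (n + j)%N%:Z = xc x j%:Z) ->
  forall k' i j p, (k' <= k)%N -> superpatch 0 k' i (j, p) ->
  superpatch n k' i (j, c n *: p).
Proof.
move=> h; elim=> [|k' IH] i j p kk; first by move=> /= [-> ->]; rewrite scaler0.
move=> [j' [l [lk hp]]]; exists j', l; rewrite h //; split => //.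
rewrite (cexp_recurrent _ _ h) // -scalerA -scalerBr.
exact: IH (ltnW kk) hp.
Qed.

(** Refers to a single finite supertile, so that it depends on a finite word of [x] only and can
    recur at higher levels. *)
Definition return_vector (v : V) := exists k i j p,
  superpatch 0 k i (j, p) /\ superpatch 0 k i (j, p + v).

Lemma return_vector_level v : return_vector v -> forall r, exists n j p,
  [/\ r <= c n, level n (j, p) & level n (j, p + c n *: v)].
Proof.
move=> [k [i [j [p [h1 h2]]]]] r; have [n [hn hrec]] := recurrent_scale k r.
have [q hq] := level_type (n + k) i.
exists n, j, (c n *: p + q); split => //.
  exact: level_superpatch hq (superpatch_recurrent _ _ hrec _ _ _ _ (leqnn _) h1).
rewrite addrAC -scalerDr.
exact: level_superpatch hq (superpatch_recurrent _ _ hrec _ _ _ _ (leqnn _) h2).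
Qed.

Lemma return_vector_level0 v : return_vector v -> exists j p,
  level 0 (j, p) /\ level 0 (j, p + v).
Proof.
move=> [k [i [j [p [h1 h2]]]]]; have [q hq] := level_type (0 + k) i.
exists j, (p + q); split; first exact: level_superpatch hq h1.
by rewrite addrAC; exact: level_superpatch hq h2.
Qed.

(** By packing, at most [P] level-[m] supertiles meet the segment; [segment_chain] links them. The
    bound is uniform in the level when [P] comes from [level_packing]. *)
Lemma level_chain m (r : R) (P : nat) (Rel : nat -> tile -> tile -> Prop) :
  (forall z, exists s : seq tile, [/\ (size s <= P)%N, (forall tl, tl \in s -> level m tl)
    & forall tl y, level m tl -> stile m tl y -> `|y - z| <= r * c m -> tl \in s]) ->
  (forall a, level m a -> Rel 0%N a a) ->
  (forall n a b e y, level m a -> level m b -> level m e -> stile m a y -> stile m b y ->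
     Rel n b e -> Rel n.+1 a e) ->
  forall u w, `|w - u| <= r * c m -> exists a b n,
    [/\ level m a, level m b, (n < P)%N, stile m a u /\ stile m b w & Rel n a b].
Proof.
move=> pack R0 RS u w uw; have [s [sP sl hs]] := pack u.
have [] := segment_chain (fun a (_ : level m a) => closed_stile m a) R0 RS u w sl.
  move=> q /andP[q0 q1]; have [a la aq] := level_cover m (u + q *: (w - u)).
  exists a => //; apply: hs la aq _.
  rewrite addrC addKr normrZ ger0_norm //; apply: le_trans uw.
  by rewrite -[leRHS]mul1r ler_wpM2r.
move=> a [b [n [la lb ns ab rel]]]; exists a, b, n; split => //.
exact: leq_trans ns sP.
Qed.

Lemma split_bound (F : V -> R) (delta B : R) : 0 < delta -> 0 <= B ->
  (forall u w, `|w - u| <= delta -> `|F w - F u| <= B) ->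
  forall u w, `|F w - F u| <= (`|w - u| / delta + 1) * B.
Proof.
move=> d0 B0 h.
have one u w : F w - F u <= (`|w - u| / delta + 1) * B.
  pose n := (Num.truncn (`|w - u| / delta)).+1.
  have n0 : 0 < n%:R :> R by rewrite ltr0n.
  have /andP[le_n lt_n] := truncn_itv (divr_ge0 (normr_ge0 (w - u)) (ltW d0)).
  have step a : F (a + n%:R^-1 *: (w - u)) - F a <= B.
    apply: le_trans (ler_norm _) _; apply: h.
    have -> : a + n%:R^-1 *: (w - u) - a = n%:R^-1 *: (w - u) by rewrite [LHS]addrC addKr.
    rewrite normrZ gtr0_norm ?invr_gt0 // mulrC ler_pdivrMr // mulrC -ler_pdivrMr //.
    exact: ltW.
  have := telescope_ub F _ B step n u.
  rewrite scalerA divff ?gt_eqF // scale1r [u + _]addrC subrK => /le_trans; apply.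
  by apply: ler_wpM2r => //; rewrite -natr1 lerD2r.
move=> u w; rewrite ler_norml one andbT lerNl opprB.
by rewrite distrC; exact: one.
Qed.

(** * Extension of a coordinate to a function on the whole space *)

Variables (U : set V) (psi : V -> R) (C0 : R).
Hypothesis U0 : U 0.
Hypothesis psiB : forall u v, U u -> U v -> U (u - v) /\ psi (u - v) = psi u - psi v.
Hypothesis psiZ : forall a u, Zthetabar theta a -> U u ->
  U (a *: u) /\ psi (a *: u) = a * psi u.
Hypothesis psi_adj : forall (tl tl' : tile) z, level 0 tl -> level 0 tl' ->
  stile 0 tl z -> stile 0 tl' z -> U (tl'.2 - tl.2) /\ `|psi (tl'.2 - tl.2)| <= C0.

Lemma psi0 : psi 0 = 0.
Proof. by have [_] := psiB _ _ U0 U0; rewrite !subrr. Qed.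

Lemma psiD u v : U u -> U v -> U (u + v) /\ psi (u + v) = psi u + psi v.
Proof.
move=> hu hv; have [hn en] := psiB _ _ U0 hv.
rewrite !sub0r in hn en; have := psiB _ _ hu hn.
by rewrite en opprK psi0 sub0r opprK.
Qed.

(** The bound that [n] successive contacts of tiles give; the relation fed to [level_chain] at level
    0. *)
Definition psi_dist (n : nat) (a b : tile) : Prop :=
  U (b.2 - a.2) /\ `|psi (b.2 - a.2)| <= n%:R * C0.

Lemma psi_dist0 a : psi_dist 0 a a.
Proof. by rewrite /psi_dist subrr psi0 normr0 mul0r. Qed.

Lemma psi_distD n k a b e : psi_dist n a b -> psi_dist k b e -> psi_dist (n + k) a e.
Proof.
move=> [u1 b1] [u2 b2]; have [u3 e3] := psiD _ _ u1 u2.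
have e4 : e.2 - a.2 = b.2 - a.2 + (e.2 - b.2) by rewrite [RHS]addrC addrA subrK.
rewrite /psi_dist e4 e3; split => //; apply: le_trans (ler_normD _ _) _.
by rewrite natrD mulrDl lerD.
Qed.

Lemma psi_dist1 a b z : level 0 a -> level 0 b -> stile 0 a z -> stile 0 b z ->
  psi_dist 1 a b.
Proof. by move=> la lb az bz; rewrite /psi_dist mul1r; exact: psi_adj la lb az bz. Qed.

Lemma C0_ge0 : 0 <= C0.
Proof.
have [tl ltl hz] := level_cover 0 0.
by have [_] := psi_adj _ _ _ ltl ltl hz hz; apply: le_trans.
Qed.

Lemma psi_dist_chain (r : R) : 0 <= r -> exists P : nat, forall a b u w,
  level 0 a -> level 0 b -> stile 0 a u -> stile 0 b w -> `|w - u| <= r -> psi_dist P a b.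
Proof.
move=> r0; have [P hP] := level_packing r r0.
(* Two extra contacts: [a] with the first tile of the chain at [u], and its last tile with [b] at
   [w]. *)
exists P.+2 => a b u w la lb au bw uw.
have RS n e f g y : level 0 e -> level 0 f -> level 0 g -> stile 0 e y -> stile 0 f y ->
    psi_dist n f g -> psi_dist n.+1 e g.
  move=> le lf _ ey fy; rewrite -add1n.
  exact: psi_distD (psi_dist1 _ _ _ le lf ey fy).
have uw' : `|w - u| <= r * c 0%N by rewrite cexp0 mulr1.
have [e [f [n [le lf nP [eu fw] ef]]]] :=
  level_chain 0 r P psi_dist (hP 0%N) (fun e _ => psi_dist0 e) RS u w uw'.
have [h1 h2] := psi_distD _ _ _ _ _ (psi_distD _ _ _ _ _ (psi_dist1 _ _ _ la le au eu) ef)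
  (psi_dist1 _ _ _ lf lb fw bw).
split => //; apply: le_trans h2 _; apply: ler_wpM2r; first exact: C0_ge0.
by rewrite ler_nat addn1 add1n; lia.
Qed.

Lemma stile_nonempty m tl : exists z, stile m tl z.
Proof.
have [e e0 he] := tiles_contain_balls; have [q hq] := he tl.1.
by exists (c m *: q + tl.2); exists q => //; apply: hq; rewrite subrr normr0.
Qed.

Lemma level0_diff a b : level 0 a -> level 0 b -> U (b.2 - a.2).
Proof.
move=> la lb; have [u au] := stile_nonempty 0 a; have [w bw] := stile_nonempty 0 b.
have [P hP] := psi_dist_chain `|w - u| (normr_ge0 _).
by have [] := hP a b u w la lb au bw (lexx _).
Qed.

Definition tile_at z := s2val (cid2 (level_cover 0 z)).

Lemma tile_atP z : level 0 (tile_at z) /\ stile 0 (tile_at z) z.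
Proof. by rewrite /tile_at; case: cid2. Qed.

Definition psi_ext z := psi ((tile_at z).2 - (tile_at 0).2).

Lemma psi_ext_diff u w : psi_ext w - psi_ext u = psi ((tile_at w).2 - (tile_at u).2).
Proof.
have U_ z z' := level0_diff _ _ (proj1 (tile_atP z)) (proj1 (tile_atP z')).
rewrite /psi_ext; have [_ <-] := psiB _ _ (U_ 0 w) (U_ 0 u).
by rewrite opprB addrA subrK.
Qed.

(** The chosen tiles at [u] and [w] may differ from [a] and [b]; each replacement is one contact and
    costs [C0]. *)
Lemma psi_ext_tiles a b u w : level 0 a -> level 0 b -> stile 0 a u -> stile 0 b w ->
  `|psi_ext w - psi_ext u - psi (b.2 - a.2)| <= 2 * C0.
Proof.
move=> la lb au bw; rewrite psi_ext_diff.
have [lu tu] := tile_atP u; have [lw tw] := tile_atP w.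
have [u1 b1] := psi_dist1 _ _ _ lb lw bw tw.
have [u2 b2] := psi_dist1 _ _ _ lu la tu au.
have [u3 e3] := psiD _ _ u1 u2; have uab := level0_diff _ _ la lb.
have -> : (tile_at w).2 - (tile_at u).2 = (b.2 - a.2) + ((tile_at w).2 - b.2 + (a.2 - (tile_at u).2)).
  by apply/rowP => i; rewrite !mxE; lra.
have [_ ->] := psiD _ _ uab u3; rewrite e3 addrC addKr.
by apply: le_trans (ler_normD _ _) _; lra.
Qed.

Lemma psi_ext_lipschitz : exists C1, forall z z',
  `|psi_ext z - psi_ext z'| <= C1 * (`|z - z'| + 1).
Proof.
have [P hP] := psi_dist_chain 1 ler01.
exists (P%:R * C0) => z z'; rewrite mulrC -[`|z - z'|]divr1.
apply: split_bound => //; first by rewrite mulr_ge0 // C0_ge0.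
move=> u w uw; rewrite psi_ext_diff.
have [lu tu] := tile_atP u; have [lw tw] := tile_atP w.
exact: (proj2 (hP _ _ _ _ lu lw tu tw uw)).
Qed.

(* One near-linear ball suffices: it contains level-n supertiles of all types,
   and psi_ext varies in the same way on all supertiles of a given type. *)
Lemma psi_ext_sublinear (eps : R) : 0 < eps -> exists g C, forall u w,
  `|psi_ext w - psi_ext u - dot (w - u) g| <= eps * `|w - u| + C.
Proof.
move=> eps0.
have [C1 lip] := psi_ext_lipschitz.
have [P hP] := level_packing 1 ler01.
have [L hL] := primitive_block 0.
have [D D0 hD] := tile_norm_bound.
have P0 : 0 < P%:R + 1 :> R by rewrite ltr_wpDl.
(* Makes [(P + 1) * eps1 * rho] equal to [eps * c n / 2] for the [rho] below. *)
pose eps1 := eps / (2 * (P%:R + 1) * (2 * D * c L)).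
have eps10 : 0 < eps1 by rewrite divr_gt0 // !mulr_gt0.
have [rho0 hrho] := near_linear_balls lip eps10.
(* Large [n] lets [rho] reach [rho0] and keeps [(P + 1) * 4 * C0] below [eps * c n / 2]. As the
   first [L] symbols recur after [n], the same [L] serves for primitivity above level [n]. *)
have [n [hn hrec]] := recurrent_scale L
  (Num.max (rho0 / (2 * D * c L)) (8 * (P%:R + 1) * C0 / eps)).
have cnL : c (n + L)%N = c n * c L by exact: (cexp_recurrent _ _ hrec).
pose rho := 2 * D * c (n + L)%N.
have rho_ge : rho0 <= rho.
  have : rho0 / (2 * D * c L) <= c n by apply: le_trans hn; rewrite le_max lexx.
  by rewrite ler_pdivrMr ?mulr_gt0 // /rho cnL; lra.
have cn_ge : 8 * (P%:R + 1) * C0 <= eps * c n.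
  have : 8 * (P%:R + 1) * C0 / eps <= c n by apply: le_trans hn; rewrite le_max lexx orbT.
  by rewrite ler_pdivrMr // [X in _ <= X]mulrC.
have [z0 [g hg]] := hrho rho rho_ge.
exists g.
have [[i0 q0] li0 z0i] := level_cover (n + L) z0.
have inball z : stile (n + L) (i0, q0) z -> `|z - z0| <= rho.
  move: z0i => [a0 ta0 ->] [a ta ->].
  have -> : c (n + L) *: a + q0 - (c (n + L) *: a0 + q0) = c (n + L) *: (a - a0).
    by rewrite scalerBr opprD addrACA subrr addr0.
  rewrite normrZ gtr0_norm // /rho mulrC ler_pM2r //.
  apply: le_trans (ler_normB _ _) _.
  by have := hD _ _ ta; have := hD _ _ ta0; rewrite /=; lra.
pose omega := eps1 * rho + 4 * C0.
(* Compare the supertile with one of the same type, placed at [pr] inside the ball. Both are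
   subdivided alike, so differences between corresponding tiles agree, and passing between [psi] and
   [psi_ext] costs [2 * C0] on each side. *)
have osc tl u w : level n tl -> stile n tl u -> stile n tl w ->
    `|psi_ext w - psi_ext u - dot (w - u) g| <= omega.
  case: tl => j p lj ju jw.
  have [p' hp'] := hL i0 j.
  have hp'' := superpatch_recurrent _ _ hrec _ _ _ _ (leqnn _) hp'.
  have lref := level_superpatch _ _ _ _ _ _ li0 hp''.
  set pr := c n *: p' + q0 in lref.
  have sub0 z : stile n (j, p) z -> exists j' p0, 
      [/\ superpatch 0 n j (j', p0), stile 0 (j', p0 + p) z,
        stile 0 (j', p0 + pr) (z + (pr - p)) & `|z + (pr - p) - z0| <= rho].
    move=> /stile_shift hz.
    have [[j' p0] h1 h2] := superpatch_cover subst (m := 0) hz.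
    exists j', p0; split => //.
    - by have := stile_transl p h2; rewrite subrK.
    - by have := stile_transl pr h2; rewrite -addrA [- p + _]addrC.
    - apply: inball; apply/stile_shift; apply: (superpatch_sub subst hp'').
      have := stile_transl (c n *: p') hz.
      rewrite add0r /pr; congr (stile _ _ _).
      by apply/rowP => i; rewrite !mxE; lra.
  have [ju' [pu [u1 u2 u3 u4]]] := sub0 _ ju.
  have [jw' [pw [w1 w2 w3 w4]]] := sub0 _ jw.
  have e1 := psi_ext_tiles _ _ _ _ (level_superpatch 0 n _ _ _ _ lj u1)
    (level_superpatch 0 n _ _ _ _ lj w1) u2 w2.
  have e2 := psi_ext_tiles _ _ _ _ (level_superpatch 0 n _ _ _ _ lref u1)
    (level_superpatch 0 n _ _ _ _ lref w1) u3 w3.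
  have e3 := hg _ _ w4 u4.
  have cancel (y y' s : V) : y + s - (y' + s) = y - y' by rewrite opprD addrACA subrr addr0.
  move: e1 e2 e3; rewrite /= !cancel /omega.
  rewrite !ler_norml => /andP[a1 a2] /andP[a3 a4] /andP[a5 a6].
  by apply/andP; split; lra.
have omega0 : 0 <= omega.
  have rho0' : 0 < rho by rewrite /rho !mulr_gt0.
  by apply: addr_ge0; apply: mulr_ge0; rewrite ?C0_ge0 // ltW.
exists (P%:R * omega) => u w.
pose G z := psi_ext z - dot z g.
have GE u' w' : G w' - G u' = psi_ext w' - psi_ext u' - dot (w' - u') g.
  by rewrite /G dotDl dotNl; lra.
pose Rel k a b := forall u w, stile n a u -> stile n b w -> `|G w - G u| <= (k%:R + 1) * omega.
(* Displacements are cut into steps of length at most [c n], each crossing a chain of at most [P]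
   level-[n] supertiles. *)
have bound := split_bound G (c n) (P%:R * omega) (c0 n) _ _ u w.
rewrite -GE; apply: le_trans (bound _ _) _.
- by rewrite mulr_ge0.
- move=> u' w' uw'.
  have R0 a : level n a -> Rel 0%N a a.
    by move=> la u1 w1 au aw; rewrite GE add0r mul1r; exact: osc la au aw.
  have RS k a b e y : level n a -> level n b -> level n e -> stile n a y -> stile n b y ->
      Rel k b e -> Rel k.+1 a e.
    move=> la lb le ay by_ h u1 w1 au ew.
    have h1 := h y w1 by_ ew; have h2 := osc a u1 y la au ay; rewrite -GE in h2.
    have -> : G w1 - G u1 = (G w1 - G y) + (G y - G u1) by rewrite addrA subrK.
    by apply: le_trans (ler_normD _ _) _; rewrite -natr1; lra.
  have uw1 : `|w' - u'| <= 1 * c n by rewrite mul1r.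
  have [a [b [k [la lb kP [au bw] rel]]]] := level_chain n 1 P Rel (hP n) R0 RS u' w' uw1.
  apply: le_trans (rel _ _ au bw) _; apply: ler_wpM2r => //.
  by rewrite natr1 ler_nat.
rewrite mulrDl mul1r lerD2r mulrAC -mulrA mulrC ler_wpM2r //.
rewrite ler_pdivrMr //.
have e1 : (P%:R + 1) * (eps1 * rho) = eps * c n / 2.
  rewrite /eps1 /rho cnL; field; rewrite !gt_eqF //=.
have : P%:R * omega <= (P%:R + 1) * omega by rewrite ler_wpM2r // lerDl.
rewrite {2}/omega [X in _ <= X -> _]mulrDr e1; lra.
Qed.

Lemma return_vector_almost_linear (eps : R) : 0 < eps -> exists g : V, forall v,
  return_vector v -> U v /\ `|psi v - dot v g| <= eps * `|v|.
Proof.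
move=> eps0; have [g [C hg]] := psi_ext_sublinear eps eps0.
exists g => v rv.
have Uv : U v.
  have [j [p [h1 h2]]] := return_vector_level0 v rv.
  by have := level0_diff _ _ h1 h2; rewrite /= addrC addKr.
split => //; rewrite leNgt; apply/negP; rewrite -subr_gt0 => X0.
set X := _ - _ in X0.
(* Scaling by [c n] multiplies the excess [X], while the additive error stays [C + 2 * C0]; this [n]
   makes [c n * X] too large. *)
have [n [j [p [hn h1 h2]]]] := return_vector_level v rv ((C + 2 * C0) / X + 1).
have [y hy] := stile_nonempty n (j, p).
move: hy => /stile_shift hy.
have [[b p0] k1 k2] := superpatch_cover subst (m := 0) hy.
have l1 := level_superpatch 0 n _ _ _ _ h1 k1.
have l2 := level_superpatch 0 n _ _ _ _ h2 k1.
have s1 := stile_transl p k2.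
have s2 := stile_transl (p + c n *: v) k2.
have := psi_ext_tiles _ _ _ _ l1 l2 s1 s2.
have := hg (y - p + p) (y - p + (p + c n *: v)).
have -> : y - p + (p + c n *: v) - (y - p + p) = c n *: v.
  by apply/rowP => i; rewrite !mxE; lra.
rewrite /=; have -> : p0 + (p + c n *: v) - (p0 + p) = c n *: v.
  by apply/rowP => i; rewrite !mxE; lra.
have [_ ->] := psiZ _ _ (cexp_Zt theta x n) Uv.
rewrite dotZl normrZ (gtr0_norm (c0 n)) => a1 a2.
have a3 : c n * `|psi v - dot v g| <= eps * (c n * `|v|) + (C + 2 * C0).
  rewrite -[X in X * _](gtr0_norm (c0 n)) -normrM mulrBr.
  move: a1 a2; rewrite !ler_norml => /andP[b1 b2] /andP[b3 b4].
  by apply/andP; split; lra.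
have : c n * X <= C + 2 * C0 by rewrite /X mulrBr; lra.
apply/negP; rewrite -ltNge -ltr_pdivrMr //.
by apply: lt_le_trans hn; rewrite ltrDl.
Qed.

End BuiltTiling.
Arguments level {R d M N} theta kappa tau x ii vv m tl.
Arguments return_vector {R d M N} theta kappa tau x v.
Arguments level_common {R d M N theta kappa tau x ii vv} _ [m tl tl'] _ _.
Arguments level_cover {R d M N t theta kappa tau x} _ {ii vv} _ _ m z.
Arguments stile_nonempty {R d M N t theta kappa tau x} _ _ _ {ii vv} _ _ m tl.
Arguments return_vector_almost_linear
  {R d M N t theta kappa tau x} _ _ _ {ii vv} _ _ _ {U psi C0} _ _ _ _ [eps] _.

(** * From almost linear coordinates to the basis *)

Lemma relation_of_almost_linear (R : realType) (d : nat) (L : set 'rV[R]_d)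
  (psi : 'rV[R]_d -> R) :
  (forall eps : R, 0 < eps -> exists g, forall v, L v ->
     `|psi v - dot v g| <= eps * `|v|) ->
  forall n (w : 'I_n -> 'rV[R]_d) (a : 'I_n -> R), (forall k, L (w k)) ->
  \sum_k a k *: w k = 0 -> \sum_k a k * psi (w k) = 0.
Proof.
move=> hlin n w a Lw rel; set X := \sum_k _.
pose Y := \sum_k `|a k| * `|w k|.
have Y0 : 0 <= Y by apply: sumr_ge0 => k _; rewrite mulr_ge0.
apply/eqP; rewrite -normr_le0 leNgt; apply/negP => X0.
have Y1 : 0 < Y + 1 by rewrite ltr_wpDl.
(* The form [g] may vary with the error, but any linear form vanishes on the relation, leaving at
   most the error times [Y], which is smaller than [|X|] here. *)
have [g hg] := hlin (`|X| / (Y + 1)) (divr_gt0 X0 Y1).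
have dot_rel : \sum_k a k * dot (w k) g = 0.
  have <- : dot (\sum_k a k *: w k) g = \sum_k a k * dot (w k) g.
    elim/big_rec2: _ => [|k u v _ <-]; first by rewrite -(scale0r 0) dotZl mul0r.
    by rewrite dotDl dotZl.
  by rewrite rel -(scale0r 0) dotZl mul0r.
have : `|X| <= `|X| / (Y + 1) * Y.
  have eX : X = \sum_k a k * (psi (w k) - dot (w k) g).
    under eq_bigr do rewrite mulrBr.
    by rewrite sumrB dot_rel subr0.
  rewrite {1}eX; apply: le_trans (ler_norm_sum _ _ _) _; rewrite mulr_sumr.
  apply: ler_sum => k _; rewrite normrM mulrCA.
  by rewrite ler_wpM2l //; exact: hg.
rewrite mulrAC ler_pdivlMr // ler_pM2l //; lra.
Qed.
Arguments relation_of_almost_linear {R d L psi} _ {n w a} _ _.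

(** Up to a common translation, both tiles also belong to a built tiling that agrees on a large
    ball; their difference is unchanged, and nestedness puts them into one supertile. *)
Lemma Lambda_return_vector (R : realType) (d M N : nat)
  (t : 'I_M -> set 'rV[R]_d) (theta : sym N -> R)
  (kappa : sym N -> 'I_M -> 'I_M -> nat)
  (tau : sym N -> 'I_M -> 'I_M -> nat -> 'rV[R]_d) (x : Sigma N) (v : 'rV[R]_d) :
  (forall j, exists a, t j a) -> Lambda t theta kappa tau x v ->
  return_vector theta kappa tau x v.
Proof.
move=> ne [T [hT [j [p [Tp Tpv]]]]]; have [a ta] := ne j.
(* The radius of agreement: by |y - u|^2 <= 2 |y|^2 + 2 |u|^2 with |u| < 1, it reaches a point of
   each of the two shifted tiles. *)
pose E : R := 3 + 2 * sqn (a + p) + 2 * sqn (a + (p + v)).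
have E3 : 3 <= E by have := sqn_ge0 (a + p); have := sqn_ge0 (a + (p + v)); rewrite /E; lra.
have E0 : 0 < E by lra.
have Ei : E^-1 ^+ 2 <= 1 by rewrite exprVn invf_le1 ?exprn_gt0 // expr_ge1 //; lra.
have [|T0 [w [u [u' [bT0 su su' agree]]]]] := hT E^-1 _; first by rewrite invr_gt0.
have near (y : 'rV[R]_d) : 2 * sqn y + 3 <= E -> sqn (y - u) < E^-1^-1 ^+ 2.
  move=> hy; have := sqn_ge0 (y + u); rewrite !sqnD sqnN (dotC _ (- u)) dotNl dotC invrK.
  have : E <= E ^+ 2 by rewrite expr2 ler_peMl //; lra.
  lra.
have move_tile q : T (j, q) -> 2 * sqn (a + q) + 3 <= E -> T0 (j, q - u + u' - w).
  move=> Tq hq; have [] := agree (j, q - u).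
    exists (a + q - u); split; last exact: near.
    by exists a; rewrite //= addrA.
  by rewrite /transl_patch /= !opprK subrK => /(_ Tq).
have h1 := move_tile p Tp; have h2 := move_tile (p + v) Tpv.
have {}h1 : T0 (j, p - u + u' - w).
  by apply: h1; have := sqn_ge0 (a + (p + v)); rewrite /E; lra.
have {}h2 : T0 (j, p - u + u' - w + v).
  have -> : p - u + u' - w + v = p + v - u + u' - w by apply/rowP => i; rewrite !mxE; lra.
  by apply: h2; have := sqn_ge0 (a + p); rewrite /E; lra.
have [ii [vv [nest eT _]]] := bT0; rewrite eT in h1 h2.
have lev q : (exists k, transl_patch (supertile theta kappa tau x k (ii k)) (vv k) (j, q)) ->
    level theta kappa tau x ii vv 0 (j, q).
  by move=> [k /superpatch0 hk]; exists k.
have [k [k1 k2]] := level_common nest (lev _ h1) (lev _ h2).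
exists k, (ii (0 + k)%N), j, (p - u + u' - w - vv (0 + k)%N); split; first exact: k1.
by rewrite [_ + v]addrAC; exact: k2.
Qed.

(* N.+1 substitution rules S_l (l : sym N = 'I_N.+1) on M prototiles in R^d. *)
Theorem theorem4 (R : realType) (d M N : nat)
  (t : 'I_M -> set 'rV[R]_d) (theta : sym N -> R)
  (kappa : sym N -> 'I_M -> 'I_M -> nat)
  (tau : sym N -> 'I_M -> 'I_M -> nat -> 'rV[R]_d)
  (mu : probability (SigmaM N) R) :
  (forall i, @compact 'rV[R]_d (t i)) ->
  (forall l, substitution_rule t theta kappa tau l) ->
  compatible t theta kappa tau ->
  minimal kappa mu -> shift_invariant mu -> shift_ergodic mu ->
  {ae mu, forall x : SigmaM N,
    exists b : 'M[R]_d, b \in unitmx /\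
      forall v : 'rV[R]_d, Lambda t theta kappa tau x v ->
        exists c : 'rV[R]_d, (forall i, Zthetabar theta (c ord0 i)) /\ v = c *m b}.
Proof.
move=> compact_t subst compat min inv _.
apply: filterS2 min (recurrent_words inv) => x minx recx.
(* Without return vectors any basis will do; otherwise [Omega] provides a built tiling, whose nested
   supertiles carry the argument. *)
have [[v0 [T [hT _]]]|nL] := pselect (exists v, Lambda t theta kappa tau x v); last first.
  exists 1%:M; rewrite unitmx1; split => // v Lv; by case: nL; exists v.
have [T0 [_ [_ [_ [[ii [vv [nest eT cov]]] _ _ _]]]]] := hT 1 ltr01.
have covering z : exists k tl, superpatch theta kappa tau x 0 k (ii k) (tl.1, tl.2 - vv k)
    /\ tile_set t tl z.
  have [tl []] := cov z; rewrite eT => -[k /superpatch0 hk] hz.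
  by exists k, tl.
have [K [g hg]] := finite_adjacency compat.
have [U [phi [D [D0 Urow phiB phiZ phiD]]]] := coordinates_exist theta g.
have adj tl tl' z : level theta kappa tau x ii vv 0 tl ->
    level theta kappa tau x ii vv 0 tl' ->
    stile t theta x 0 tl z -> stile t theta x 0 tl' z ->
    exists r, tl'.2 - tl.2 = row r g.
  case: tl tl' => [j p] [j' p'] l1 l2 s1 s2.
  have [k [/superpatch0 k1 /superpatch0 k2]] := level_common nest l1 l2.
  have shiftE' j0 p0 : stile t theta x 0 (j0, p0) z -> tile_set t (j0, p0 - vv k) (z - vv k).
    by rewrite -(stile0 t theta x); exact: stile_transl.
  have [r] := hg x k _ _ _ _ k1 k2 (shiftE' _ _ s1) (shiftE' _ _ s2).
  by rewrite /= opprB addrA subrK => e; exists r.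
have U0 : U 0.
  have [tl l0 s0] := level_cover subst nest covering 0 0.
  by have [r] := adj _ _ _ l0 l0 s0 s0; rewrite subrr => ->.
have linear (i : 'I_K) (eps : R) : 0 < eps -> exists g0 : 'rV[R]_d, forall v,
    return_vector theta kappa tau x v ->
    U v /\ `|phi v ord0 i - dot v g0| <= eps * `|v|.
  move=> eps0.
  apply: (return_vector_almost_linear compact_t subst minx nest covering recx
    (psi := fun v => phi v ord0 i)
    (C0 := \big[Num.max/0]_r `|phi (row r g) ord0 i|) U0 _ _ _ eps0).
  - by move=> u v Uu Uv; have [h ->] := phiB u v Uu Uv; rewrite !mxE.
  - by move=> a u Oa Uu; have [h ->] := phiZ a u Oa Uu; rewrite !mxE.
  - move=> tl tl' z l1 l2 s1 s2; have [r ->] := adj _ _ _ l1 l2 s1 s2.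
    split; first exact: Urow.
    exact: (le_bigmax _ (fun r => `|phi (row r g) ord0 i|)).
have ne j : exists a, t j a.
  have [z [a ta _]] := stile_nonempty compact_t subst minx nest covering 0 (j, 0).
  by exists a.
have retL v : Lambda t theta kappa tau x v -> return_vector theta kappa tau x v.
  exact: Lambda_return_vector.
apply: (@basis_of_real_relations R N theta K d g D phi (Lambda t theta kappa tau x) D0) => //.
  move=> v /retL rv; apply: phiD.
  (* Applied to the zero function, only to obtain [U v]; this requires no coordinate index, so
     [K = 0] is covered. *)
  have [||tl tl' z l1 l2 s1 s2|g0 /(_ v rv)[//]] := return_vector_almost_linear compact_t subst minx
    nest covering recx (psi := fun=> 0) (C0 := 0) U0 _ _ _ ltr01.
  - by move=> u w Uu Uw; have [h _] := phiB u w Uu Uw; rewrite subrr.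
  - by move=> a u Oa Uu; have [h _] := phiZ a u Oa Uu; rewrite mulr0.
  - have [r ->] := adj _ _ _ l1 l2 s1 s2; split; [exact: Urow|by rewrite normr0].
move=> n w a Lw rel; apply/rowP => i; rewrite mxE summxE.
rewrite -[RHS](relation_of_almost_linear (psi := fun v => phi v ord0 i) _ Lw rel).
  by apply: eq_bigr => k _; rewrite mxE.
move=> eps eps0; have [g0 hg0] := linear i eps eps0.
by exists g0 => v /retL /hg0[].
Qed.
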